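(* Let $\{X_n\}_{n\ge 1}$ be a sequence of discrete random variables such that, for each $n\ge1$, the probability generating function $\mathbb{E}(z^{X_n})$ is a polynomial of degree $n$ all of whose roots $\rho_j$ lie on the unit circle, $|\rho_j|=1$. Let $X_n^* := (X_n-\mathbb{E}(X_n))/\sqrt{\mathbb{V}(X_n)}$. Then: (1) (Bounds for the fourth normalized central moment) For all $n\ge1$, $$1\le \mathbb{E}\left((X_n^* )^4\right) < 3 .$$ (2) (Asymptotic normality) The sequence $\{X_n^*\}$ converges in distribution (and with all moments) to the standard normal law $\mathscr{N}(0,1)$ if and only if $\mathbb{E}\left((X_n^* )^4\right)\to 3$ as $n\to\infty$. (3) (Asymptotic Bernoulli distribution) The sequence $\{X_n^*\}$ converges in distribution to the Bernoulli random variable assuming the two values $-1$ and $1$ with equal probabilities if and only if $\mathbb{E}\left((X_n^* )^4\right)\to 1$ as $n\to\infty$.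
   Context: $\mathbb{V}$ denotes variance. Each $X_n$ takes values in $\{0,1,\dots,n\}$, and $\mathbb{E}(z^{X_n})=\sum_k \mathbb{P}(X_n=k)z^k$. ''With all moments'' means that $\mathbb{E}((X_n^* )^m)$ converges to the $m$-th moment of the limit law for every integer $m\ge0$. *)

(* Defs.v *)
From HB Require Import structures.
From mathcomp Require Import all_boot all_order all_algebra.
From mathcomp Require Import all_classical all_reals all_analysis.
From mathcomp Require Import complex.

Set Implicit Arguments.
Unset Strict Implicit.
Unset Printing Implicit Defensive.

Import Order.TTheory GRing.Theory Num.Theory.
Import numFieldNormedType.Exports.

Local Open Scope classical_set_scope.
Local Open Scope ring_scope.

Section random_variables.
Context d (T : measurableType d) (R : realType) (P : probability T R).

(* E(z^X) as a polynomial in z, for X with values in {0, ..., n}. *)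
Definition prob_gen_poly (n : nat) (X : {RV P >-> R}) : {poly R} :=
  \poly_(k < n.+1) pmf X k%:R.

Definition standardize (X : {RV P >-> R}) (t : T) : R :=
  (X t - fine 'E_P[X]) / Num.sqrt (fine 'V_P[X]).

Lemma measurable_standardize (X : {RV P >-> R}) :
  measurable_fun setT (standardize X).
Proof.
by apply: measurable_realfun.measurable_funM => //; apply: measurable_realfun.measurable_funB.
Qed.

HB.instance Definition _ (X : {RV P >-> R}) :=
  @isMeasurableFun.Build _ _ _ _ (standardize X) (measurable_standardize X).

Definition moment (m : nat) (X : T -> R) : \bar R := 'E_P[fun t => X t ^+ m].

End random_variables.

(* The modulus on R[i] is itself R[i]-valued, so 1 below is the complex 1. *)
Definition unit_roots (R : realType) (p : {poly R}) : Prop :=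
  forall rho : R[i], root (map_poly (real_complex R) p) rho -> `|rho| = 1.

Section convergence.
Context (R : realType) (d : nat -> measure_display)
  (T : forall n, measurableType (d n)) (P : forall n, probability (T n) R)
  (d' : measure_display) (T' : measurableType d') (Q : probability T' R).

Definition cvg_in_distribution (Y : forall n, {RV P n >-> R})
    (Z : {RV Q >-> R}) : Prop :=
  forall x : R, {for x, continuous (cdf Z)} ->
    cdf (Y n) x @[n --> \oo] --> cdf Z x.

Definition cvg_moments (Y : forall n, {RV P n >-> R})
    (Z : {RV Q >-> R}) : Prop :=
  forall m : nat, moment (P n) m (Y n) @[n --> \oo] --> moment Q m Z.

End convergence.

Section limit_laws.
Context (R : realType).

Definition std_normal_fun : measurableTypeR R -> R := idfun.

HB.instance Definition _ :=
  @isMeasurableFun.Build _ _ _ _ std_normal_fun (@measurable_id _ _ setT).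

(* Parameters of normal_prob: mean 0, standard deviation 1. *)
Definition std_normal : {RV (normal_prob (0 : R) 1) >-> R} := std_normal_fun.

Definition sign_fun (b : bool) : R := if b then 1 else -1.

Lemma measurable_sign_fun : measurable_fun setT sign_fun.
Proof. by []. Qed.

HB.instance Definition _ :=
  @isMeasurableFun.Build _ _ _ _ sign_fun measurable_sign_fun.

Definition sym_bernoulli : {RV (bernoulli_prob (2^-1 : R)) >-> R} := sign_fun.

End limit_laws.

Arguments std_normal : clear implicits.
Arguments sym_bernoulli : clear implicits.

(* Main.v *)
Require Import Defs.
From HB Require Import structures.
From mathcomp Require Import all_boot all_order all_algebra.
From mathcomp Require Import all_classical all_reals all_analysis.
From mathcomp Require Import complex.
From mathcomp Require Import measurable_realfun.
From mathcomp Require Import ring lra.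

Set Implicit Arguments.
Unset Strict Implicit.
Unset Printing Implicit Defensive.

Import Order.TTheory GRing.Theory Num.Theory.
Import numFieldNormedType.Exports.

Local Open Scope classical_set_scope.
Local Open Scope ring_scope.

(** Let [P] be the generating polynomial of [X], a variable in [{0, ..., n}] with
    [n >= 1], and let [Y] be the standardized variable. Since [P] is real, its roots
    form a multiset stable under conjugation, and pairing each root [rho] with
    its conjugate in [P^2] gives, because [P(1) = 1],
    [P(z)^2 = prod_j (z + v_j (z - 1)^2)] with [v_j = 1 / (2 (1 - Re rho_j))]
    ([unit_roots_square]). The only trace left by the roots is the list of
    weights [v_j >= 1/4]. As [P] has nonnegative coefficients and [P^2] is
    palindromic, [P] is palindromic too ([palindromic]), so [X] is symmetric
    about its mean. Expanding [P^2] at [z = 1] gives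
    [E X = n / 2], [Var X = V = sum_j v_j] and
    [E Y^4 = 3 + (V - 6 sum_j v_j^2) / V^2]
    ([unit_roots_moments], [unitary_law]). As [v_j >= 1/4], the numerator is
    negative, whence the upper bound; the lower bound is
    [E (Y^2 - 1)^2 >= 0].

    Normal limit. By the formula above, a fourth moment tending to 3 is the same
    as [sum_j v_j^2 / V^2 -> 0]. Evaluating [P^2] at [e^t] with
    [t = s / sqrt V] writes the square of the moment generating function
    [E e^(s Y)] as [prod_j (1 + v_j (e^(t/2) - e^(-t/2))^2)]; since
    [exp(x - x^2) <= 1 + x <= exp x], it tends to [e^(s^2)]
    ([mgf_gaussian]). Convergence of moment generating functions gives
    convergence of all moments, by reading off Taylor coefficients
    ([coef_cvg]), and then of [E cos(t Y)]. Polynomials in [cos(t y)]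
    approximate indicators of intervals symmetric about 0, up to a Chebyshev
    bound at infinity ([cos_step]), and for symmetric laws these intervals
    determine the distribution function ([cvg_in_distribution_of_mgf]).
    Conversely, under convergence in distribution to a normal [N], mass may escape
    to infinity but cannot come from there, so that [liminf E Y^4 >= E N^4 = 3]
    ([fourth_moment_lsc]), and 3 is also an upper bound.

    Bernoulli limit. Here [E (Y^2 - 1)^2 = E Y^4 - 1] measures how far the
    law is from the two points 1 and -1. If it tends to 0, a Chebyshev argument
    and symmetry give the limit law; conversely the moment generating functions
    are bounded, so that convergence in distribution makes it tend to 0. *)

(** * Real analysis *)

Section real_analysis.
Context (R : realType).
Implicit Types (x y r : R) (c : nat -> R).

(** Rescaling trades the tail of an exponential series for a power of [r]: for
    [k >= K] one has [r^k <= r^K], so each term is at most [r^K] times the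
    corresponding term of the series of [exp(|x| / r)]. With [r] in front, the
    bound serves both for small arguments and for large truncation orders. *)
Lemma exp_tail_sum c x r (K N : nat) : (forall k, `|c k| <= 1) ->
  0 < r -> r <= 1 ->
  `|\sum_(K <= k < N) c k * (x ^+ k / k`!%:R)| <= r ^+ K * expR (`|x| / r).
Proof.
move=> c1 r0 r1.
have xr0 : 0 <= `|x| / r by rewrite divr_ge0// ltW.
have partial_le M : \sum_(0 <= k < M) (`|x| / r) ^+ k / k`!%:R <= expR (`|x| / r).
  rewrite /expR; apply: nondecreasing_cvgn_le.
    apply/nondecreasing_seqP => n.
    by rewrite /series /= big_nat_recr//= lerDl exp_coeff_ge0.
  exact: is_cvg_series_exp_coeff.
apply: (le_trans (ler_norm_sum _ _ _)).
apply: (@le_trans _ _ (\sum_(K <= k < N) r ^+ K * ((`|x| / r) ^+ k / k`!%:R))).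
  rewrite !big_nat; apply: ler_sum => k /andP[Kk _].
  rewrite normrM normrM normfV normrX (ger0_norm (ler0n _ _)).
  rewrite -[leLHS]mulr1 mulrAC mulrA.
  apply: (@le_trans _ _ (1 * (`|x| ^+ k / k`!%:R))).
    by rewrite mulr1 -mulrA ler_wpM2r// divr_ge0// exprn_ge0.
  rewrite mul1r mulrA ler_wpM2r ?invr_ge0//.
  rewrite expr_div_n mulrCA ler_peMr ?exprn_ge0//.
  have rk : 0 < r ^+ k by rewrite exprn_gt0.
  by rewrite ler_pdivlMr// mul1r ler_wiXn2l// ltW.
have rK : 0 <= r ^+ K by rewrite exprn_ge0// ltW.
rewrite -mulr_sumr ler_wpM2l//.
apply: le_trans _ (partial_le N).
have [KN|/ltnW NK] := leqP K N; last first.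
  rewrite big_geq// sumr_ge0// => k _.
  by rewrite divr_ge0// exprn_ge0.
rewrite (@big_cat_nat _ _ _ K 0 N)//= lerDr sumr_ge0// => k _.
by rewrite divr_ge0// exprn_ge0.
Qed.

Lemma exp_tail c x r (K : nat) f : (forall k, `|c k| <= 1) ->
  0 < r -> r <= 1 ->
  series (fun k => c k * (x ^+ k / k`!%:R)) @ \oo --> f ->
  `|f - \sum_(k < K) c k * (x ^+ k / k`!%:R)| <= r ^+ K * expR (`|x| / r).
Proof.
move=> c1 r0 r1 cf.
have cvg_rem : (fun N => \sum_(K <= k < N) c k * (x ^+ k / k`!%:R)) @ \oo -->
    f - \sum_(k < K) c k * (x ^+ k / k`!%:R).
  have : (fun N => series (fun k => c k * (x ^+ k / k`!%:R)) N
      - \sum_(k < K) c k * (x ^+ k / k`!%:R)) @ \oo -->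
    f - \sum_(k < K) c k * (x ^+ k / k`!%:R).
    by apply: cvgB => //; exact: cvg_cst.
  apply: cvg_trans; apply: near_eq_cvg; near=> N.
  have KN : (K <= N)%N by near: N; exact: nbhs_infty_ge.
  rewrite /series /= -(big_mkord xpredT (fun k => c k * (x ^+ k / k`!%:R))).
  by rewrite (@big_cat_nat _ _ _ K 0 N)//= addrAC subrr add0r.
apply: (cvgr_to_le (cvg_norm cvg_rem)).
by near=> N; exact: exp_tail_sum.
Unshelve. all: by end_near. Qed.

Lemma expR_tail x r (K : nat) : 0 < r -> r <= 1 ->
  `|expR x - \sum_(k < K) x ^+ k / k`!%:R| <= r ^+ K * expR (`|x| / r).
Proof.
move=> r0 r1.
have -> : \sum_(k < K) x ^+ k / k`!%:R = \sum_(k < K) 1 * (x ^+ k / k`!%:R).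
  by apply: eq_bigr => k _; rewrite mul1r.
apply: (@exp_tail (fun=> 1)) => // [k|]; first by rewrite normr1.
rewrite (_ : (fun k => _) = exp_coeff x); first exact: is_cvg_series_exp_coeff.
by apply/funext => k; rewrite mul1r.
Qed.

(** [k!] times the [k]-th Taylor coefficient of the cosine at 0. *)
Definition cos_sign (k : nat) : R := (~~ odd k)%:R * (-1) ^+ k./2.

Lemma cos_tail x r (K : nat) : 0 < r -> r <= 1 ->
  `|cos x - \sum_(k < K) cos_sign k * (x ^+ k / k`!%:R)|
    <= r ^+ K * expR (`|x| / r).
Proof.
move=> r0 r1; apply: exp_tail => // [k|].
  rewrite /cos_sign normrM normrX normrN1 expr1n mulr1.
  by case: odd; rewrite ?normr0 ?normr1.
rewrite (_ : (fun k => _) = cos_coeff x).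
  by rewrite unlock; exact: is_cvg_series_cos_coeff.
by apply/funext => k; rewrite /cos_coeff /cos_sign /= mulrA.
Qed.

(** The polynomial [(1 - u^m)^N] is a smoothed step on [[0, 1]], dropping from 1
    to 0 between [a] and [b] as soon as [N a^m] is small and [N b^m] is large.
    Both bounds are Bernoulli's inequality: [(1 - u^m)^N >= 1 - N u^m] and
    [(1 - u^m)^N <= 1 / (1 + u^m)^N <= 1 / (1 + N u^m)]. *)
Lemma step_poly (a b e : R) : 0 < a -> a < b -> b <= 1 -> 0 < e ->
  exists m N : nat, forall u, 0 <= u <= 1 ->
    [/\ 0 <= (1 - u ^+ m) ^+ N <= 1,
        u <= a -> 1 - e <= (1 - u ^+ m) ^+ N
      & b <= u -> (1 - u ^+ m) ^+ N <= e].
Proof.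
move=> a0 ab b1 e0.
have b0 : 0 < b := lt_trans a0 ab.
have bern (t : R) (N : nat) : -1 <= t -> 1 + N%:R * t <= (1 + t) ^+ N.
  move=> t1; elim: N => [|N IH]; first by rewrite expr0 mul0r addr0.
  rewrite exprS; apply: (@le_trans _ _ ((1 + t) * (1 + N%:R * t))).
    have N0 : 0 <= N%:R :> R by [].
    rewrite -natr1; have : 0 <= N%:R * (t * t) by rewrite mulr_ge0// -expr2 sqr_ge0.
    nra.
  by rewrite ler_wpM2l//; lra.
(* This choice of m leaves room for an integer N with N a^m <= e and
   1 / e <= 1 + N b^m; the integer part of e / a^m is one. *)
have [m ham] : exists m : nat, (a / b) ^+ m <= e * (e / (1 + e)).
  have q1 : `|a / b| < 1.
    by rewrite ger0_norm ?divr_ge0 ?ltW// ltr_pdivrMr// mul1r.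
  have := cvg_expr q1 => /cvgr0Pnorm_le /(_ (e * (e / (1 + e)))).
  case=> [|M _ /(_ M (leqnn _))]; first by rewrite mulr_gt0// divr_gt0// addr_gt0.
  move=> /= H; exists M; apply: le_trans _ H; exact: ler_norm.
have am0 : 0 < a ^+ m by rewrite exprn_gt0.
have bm0 : 0 < b ^+ m by rewrite exprn_gt0.
have eam0 : 0 <= e / a ^+ m by rewrite divr_ge0// ltW.
exists m, (Num.truncn (e / a ^+ m)) => u /andP[u0 u1].
have /andP[N1 N2] := truncn_itv eam0.
set N := Num.truncn _ in N1 N2 *.
have um0 : 0 <= u ^+ m by rewrite exprn_ge0.
have um1 : u ^+ m <= 1 by rewrite exprn_ile1.
have um2 : 0 <= 1 - u ^+ m by lra.
split.
- by rewrite exprn_ge0//= exprn_ile1// lerBlDr lerDl.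
- move=> ua; apply: le_trans _ (bern (- (u ^+ m)) N _); last lra.
  rewrite mulrN lerB//; apply: (@le_trans _ _ (N%:R * a ^+ m)).
    by rewrite ler_wpM2l// lerXn2r// ?nnegrE// ltW.
  by rewrite -ler_pdivlMr.
- move=> bu.
  have bmum : b ^+ m <= u ^+ m by rewrite lerXn2r// ?nnegrE// ltW.
  have prod1 : (1 - u ^+ m) ^+ N * (1 + u ^+ m) ^+ N <= 1.
    rewrite -exprMn exprn_ile1//; first nra.
    have : 0 <= u ^+ m * u ^+ m by exact: mulr_ge0.
    by nra.
  have Nb : e^-1 <= 1 + N%:R * u ^+ m.
    apply: (@le_trans _ _ (1 + N%:R * b ^+ m)); last by rewrite lerD2l ler_wpM2l.
    have bam : 1 + e^-1 <= e / a ^+ m * b ^+ m.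
      move: ham; rewrite expr_div_n ler_pdivrMr// => ham.
      rewrite mulrAC ler_pdivlMr//.
      have -> : 1 + e^-1 = (1 + e) / e.
        by rewrite mulrDl mul1r divff ?gt_eqF// addrC.
      rewrite -(@ler_pM2r _ (e * (e / (1 + e)))); last first.
        by rewrite mulr_gt0// divr_gt0// addr_gt0.
      rewrite [leLHS](_ : _ = e * a ^+ m); last first.
        by field; rewrite !gt_eqF// addr_gt0.
      rewrite -mulrA ler_pM2l//; apply: (le_trans ham).
      by rewrite mulrC.
    move: N2; rewrite -natr1 => N2.
    have : e / a ^+ m * b ^+ m <= (N%:R + 1) * b ^+ m.
      by rewrite ler_pM2r// ltW.
    have bm1 : b ^+ m <= 1 by rewrite exprn_ile1// ltW.
    by rewrite mulrDl mul1r; lra.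
  have pos : 0 < (1 + u ^+ m) ^+ N by rewrite exprn_gt0// ltr_pwDl.
  have : (1 - u ^+ m) ^+ N <= ((1 + u ^+ m) ^+ N)^-1.
    by rewrite -[leRHS]mul1r ler_pdivlMr.
  move=> /le_trans; apply; rewrite -[leRHS]invrK lef_pV2 ?posrE ?invr_gt0//.
  by apply: (le_trans Nb); apply: bern; lra.
Qed.

End real_analysis.

Section sequences_of_reals.
Context (R : realType).

Lemma cvg_sumr (I : Type) (l : seq I) (f : nat -> I -> R) (b : I -> R) :
  (forall i, f n i @[n --> \oo] --> b i) ->
  \sum_(i <- l) f n i @[n --> \oo] --> \sum_(i <- l) b i.
Proof.
move=> fb; elim: l => [|i l IH].
  by rewrite big_nil; under eq_fun do rewrite big_nil; exact: cvg_cst.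
by rewrite big_cons; under eq_fun do rewrite big_cons; exact: cvgD.
Qed.

(** Taylor coefficients at 0 converge when the functions converge pointwise with
    uniform Taylor remainders. By induction on [k]: after subtraction of the
    terms of lower order, which converge, [(a n k - b k) s^k] is a vanishing
    quantity plus at most [2 C s^(k + 1)], and [s] is at our disposal. *)
Lemma coef_cvg (M : nat) (a : nat -> nat -> R) (b : nat -> R)
    (g : nat -> R -> R) (h : R -> R) (C : R) :
  (forall s, 0 < s <= 1 -> g n s @[n --> \oo] --> h s) ->
  (\forall n \near \oo, forall K s, (K <= M)%N -> 0 < s <= 1 ->
     `|g n s - \sum_(k < K) a n k * s ^+ k| <= C * s ^+ K) ->
  (forall K s, (K <= M)%N -> 0 < s <= 1 ->
     `|h s - \sum_(k < K) b k * s ^+ k| <= C * s ^+ K) ->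
  forall k, (k < M)%N -> a n k @[n --> \oo] --> b k.
Proof.
move=> cg ga hb; elim/ltn_ind => k IH kM.
have C0 : 0 <= C.
  have := hb 0%N 1 (leq0n _); rewrite ltr01 lexx => /(_ isT).
  by rewrite expr0 mulr1; apply: le_trans.
apply/cvgrPdist_le => e e0.
pose s : R := Num.min 1 (e / (4 * C + 1)).
have s0 : 0 < s by rewrite lt_min ltr01/= divr_gt0//; lra.
have s1 : s <= 1 by rewrite ge_min lexx.
have s01 : 0 < s <= 1 by rewrite s0.
have se : 2 * C * s <= e / 2.
  have : s <= e / (4 * C + 1) by rewrite ge_min lexx orbT.
  rewrite ler_pdivlMr; last lra.
  have : 0 <= s by exact: ltW.
  by nra.
(* What remains, divided by s^k, besides the two Taylor remainders. *)
pose D n := (`|h s - g n s| + \sum_(j < k) `|b j - a n j| * s ^+ j) / s ^+ k.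
have D0 : D n @[n --> \oo] --> 0.
  rewrite -(mul0r (s ^+ k)^-1); apply: cvgMl.
  rewrite -[X in _ --> X]addr0; apply: cvgD.
    have /cvgrPdist_le H := cg s s01.
    apply/cvgrPdist_le => u u0; near=> n.
    rewrite sub0r normrN normr_id; near: n; exact: H.
  rewrite -[X in _ --> X](@big1_eq _ _ +%R _ (index_enum 'I_k) xpredT).
  apply: cvg_sumr => j; rewrite -(mul0r (s ^+ j)); apply: cvgMl.
  have /cvgrPdist_le H := IH j (ltn_ord j) (ltn_trans (ltn_ord j) kM).
  apply/cvgrPdist_le => u u0; near=> n.
  rewrite sub0r normrN normr_id; near: n; exact: H.
have e20 : 0 < e / 2 by rewrite divr_gt0.
move/cvgr0Pnorm_le : D0 => /(_ _ e20) D0.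
near=> n.
have Dn : `|D n| <= e / 2 by near: n.
have gan : forall K s, (K <= M)%N -> 0 < s <= 1 ->
  `|g n s - \sum_(k < K) a n k * s ^+ k| <= C * s ^+ K by near: n.
have {gan}gan := gan k.+1 s kM s01.
have hbn := hb k.+1 s kM s01.
have sk0 : 0 < s ^+ k by rewrite exprn_gt0.
rewrite -(ler_pM2r sk0) -[X in _ * X]gtr0_norm// -normrM.
move: gan hbn; rewrite !big_ord_recr/= => gan hbn.
set A := \sum_(j < k) a n j * _ in gan; set B := \sum_(j < k) b j * _ in hbn.
have AB : `|B - A| <= \sum_(j < k) `|b j - a n j| * s ^+ j.
  rewrite -sumrB; apply: (le_trans (ler_norm_sum _ _ _)).
  apply: ler_sum => j _.
  by rewrite -mulrBl normrM (ger0_norm (exprn_ge0 _ (ltW s0))).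
have Dle : D n * s ^+ k <= e / 2 * s ^+ k.
  by rewrite ler_pM2r//; exact: le_trans (ler_norm _) Dn.
have Dk : D n * s ^+ k = `|h s - g n s| + \sum_(j < k) `|b j - a n j| * s ^+ j.
  by rewrite /D divfK// gt_eqF.
have Cs : 2 * (C * s ^+ k.+1) <= e / 2 * s ^+ k.
  rewrite (_ : 2 * _ = 2 * C * s * s ^+ k); first by rewrite ler_pM2r.
  by rewrite exprS; ring.
rewrite mulrBl.
rewrite (_ : b k * s ^+ k - a n k * s ^+ k = (h s - g n s) + - (B - A)
   - (h s - (B + b k * s ^+ k)) + (g n s - (A + a n k * s ^+ k))); last by ring.
apply: (le_trans (ler_normD _ _)).
apply: (@le_trans _ _ (`|h s - g n s| + `|B - A| + C * s ^+ k.+1 + C * s ^+ k.+1)).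
  rewrite lerD//.
  apply: (le_trans (ler_normB _ _)); rewrite lerD//.
  by apply: (le_trans (ler_normD _ _)); rewrite normrN.
by move: Dle; rewrite Dk; lra.
Unshelve. all: by end_near. Qed.

(** A lower approximation of [t^4] by a step function with jumps at
    [h, 2 h, ..., N h]: on [((j - 1) h, j h]] it equals [((j - 1) h)^4], which is
    at least [(t - h)^4] when [h <= t], and beyond [N h] the term
    [t^6 / (N h)^2] absorbs the error. It turns a fourth moment into
    probabilities of tails. *)
Lemma fourth_layers (h t : R) (N : nat) : (0 < N)%N -> 0 < h -> 0 <= t ->
  let s := \sum_(i < N) (((i.+1%:R * h) ^+ 4 - (i%:R * h) ^+ 4)
     * (i.+1%:R * h < t)%R%:R) in
  t ^+ 4 - 4 * h * t ^+ 3 - t ^+ 6 / (N%:R * h) ^+ 2 <= s <= t ^+ 4.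
Proof.
move=> N0 h0 t0 /=; set s := \sum_(i < N) _.
pose S n := \sum_(i < n) (((i.+1%:R * h) ^+ 4 - (i%:R * h) ^+ 4)
     * (i.+1%:R * h < t)%R%:R).
have inv n : (n%:R * h < t -> S n = (n%:R * h) ^+ 4) /\
    (t <= n%:R * h -> t ^+ 4 - 4 * h * t ^+ 3 <= S n <= t ^+ 4).
  elim: n => [|n [IH1 IH2]].
    rewrite /S big_ord0 mul0r expr0n; split=> // t0'.
    have -> : t = 0 by apply/eqP; rewrite eq_le t0'.
    by rewrite !expr0n/= mulr0 subr0 lexx.
  rewrite /S big_ord_recr/= -/(S n).
  have nh : n%:R * h < n.+1%:R * h by rewrite ltr_pM2r// ltr_nat.
  split=> [nt|tn].
    by rewrite nt mulr1 IH1 ?(lt_trans nh)// addrC subrK.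
  rewrite ltNge tn mulr0 addr0.
  have [/IH2//|nt] := leP t (n%:R * h).
  rewrite IH1//.
  have x0 : 0 <= n%:R * h by rewrite mulr_ge0// ltW.
  have := tn; rewrite -natr1 mulrDl mul1r => tn'.
  apply/andP; split; last by rewrite lerXn2r ?nnegrE// ltW.
  have [ht|th] := leP h t.
    have : (t - h) ^+ 4 <= (n%:R * h) ^+ 4.
      by rewrite lerXn2r ?nnegrE//; lra.
    apply: le_trans.
    rewrite -subr_ge0 (_ : _ - _ =
      h ^+ 2 * ((t * 2 - h) ^+ 2 + 2 * t ^+ 2)); last by ring.
    by rewrite mulr_ge0 ?sqr_ge0// addr_ge0 ?sqr_ge0// mulr_ge0// sqr_ge0.
  apply: (@le_trans _ _ 0); last by rewrite exprn_ge0.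
  rewrite (_ : _ - _ = - (t ^+ 3 * (4 * h - t))); last by ring.
  by rewrite oppr_le0 mulr_ge0 ?exprn_ge0//; lra.
have [Nt|tN] := ltP (N%:R * h) t; last first.
  have [_ /(_ tN)] := inv N; rewrite -/s -/(S N) => /andP[H1 H2].
  rewrite H2 andbT (le_trans _ H1)// lerBlDr lerDl divr_ge0 ?exprn_ge0//.
  by rewrite mulr_ge0// ltW.
have -> : s = (N%:R * h) ^+ 4 by have [/(_ Nt)] := inv N.
have x0 : 0 <= N%:R * h by rewrite mulr_ge0// ltW.
apply/andP; split; last by rewrite lerXn2r ?nnegrE// ltW.
apply: (@le_trans _ _ 0); last by rewrite exprn_ge0.
have xp : 0 < N%:R * h by rewrite mulr_gt0// ltr0n.
have : t ^+ 4 <= t ^+ 6 / (N%:R * h) ^+ 2.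
  rewrite ler_pdivlMr ?exprn_gt0// [leRHS](_ : _ = t ^+ 4 * t ^+ 2); last by ring.
  by rewrite ler_wpM2l ?exprn_ge0// lerXn2r ?nnegrE// ltW.
have : 0 <= h * t ^+ 3 by rewrite mulr_ge0 ?exprn_ge0// ltW.
lra.
Qed.

Lemma prod_1D_le_expR (I : eqType) (l : seq I) (x : I -> R) :
  (forall i, i \in l -> 0 <= x i) ->
  \prod_(i <- l) (1 + x i) <= expR (\sum_(i <- l) x i).
Proof.
move=> x0; rewrite expR_sum big_seq [leRHS]big_seq; apply: ler_prod => i il.
by rewrite expR_ge1Dx andbT addr_ge0// x0.
Qed.

(** [1 + x >= exp(x - x^2)] for [x >= 0], because
    [exp(- x / (1 + x)) >= 1 - x / (1 + x) = 1 / (1 + x)] and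
    [x - x^2 <= x / (1 + x)]. *)
Lemma expR_le_prod_1D (I : eqType) (l : seq I) (x : I -> R) :
  (forall i, i \in l -> 0 <= x i) ->
  expR (\sum_(i <- l) x i - \sum_(i <- l) x i ^+ 2) <= \prod_(i <- l) (1 + x i).
Proof.
move=> x0; rewrite -sumrB expR_sum big_seq [leRHS]big_seq.
apply: ler_prod => i /x0 xi; rewrite expR_ge0/=.
have p1 : 0 < 1 + x i by rewrite ltr_pwDl.
have : (1 + x i)^-1 <= expR (- (x i / (1 + x i))).
  apply: le_trans (expR_ge1Dx _).
  by rewrite -[X in X - _](@divff _ (1 + x i)) ?gt_eqF// -mulrBl addrK mul1r.
rewrite expRN lef_pV2 ?posrE ?expR_gt0// => H; apply: le_trans H.
rewrite ler_expR ler_pdivlMr//.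
have : 0 <= x i ^+ 3 by rewrite exprn_ge0.
by rewrite !exprS expr0; lra.
Qed.

(** Second order Taylor expansion of [exp] at 0, at the points [s / (2 sigma)]
    and [- s / (2 sigma)]. *)
Lemma sinh_rescaled (sigma s : R) : 0 < sigma -> `|s| <= 2 * sigma ->
  `|sigma * (expR (s / (2 * sigma)) - expR (- (s / (2 * sigma)))) - s|
    <= expR 1 * s ^+ 2 / (2 * sigma).
Proof.
move=> s0 ss; have [->|sn0] := eqVneq s 0.
  by rewrite !(mul0r, oppr0, subrr, mulr0, subr0, normr0, expr0n).
set a := s / (2 * sigma).
have an0 : 0 < `|a|.
  by rewrite normr_gt0 mulf_neq0// invr_eq0 gt_eqF// mulr_gt0.
have a1 : `|a| <= 1.
  by rewrite normrM normfV (@gtr0_norm _ (2 * sigma)) ?mulr_gt0// ler_pdivrMr ?mulr_gt0// mul1r.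
have tail b : `|b| = `|a| -> `|expR b - (1 + b)| <= a ^+ 2 * expR 1.
  move=> ba; have := expR_tail b 2 an0 a1.
  rewrite !big_ord_recr big_ord0/= add0r expr0 expr1 !divr1 ba divff ?gt_eqF//.
  by rewrite real_normK// num_real.
have H1 := tail a erefl; have H2 := tail (- a) (normrN _).
have sE : s = 2 * sigma * a by rewrite /a mulrC divfK// mulf_neq0// gt_eqF.
rewrite (_ : _ - s = sigma * ((expR a - (1 + a)) - (expR (- a) - (1 - a)))); last first.
  by rewrite {1}sE; ring.
rewrite normrM (gtr0_norm s0).
apply: (@le_trans _ _ (sigma * (2 * (a ^+ 2 * expR 1)))).
  rewrite ler_pM2l//; apply: (le_trans (ler_normB _ _)).
  by rewrite (mulrDl 1 1) mul1r lerD.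
by rewrite le_eqVlt; apply/orP; left; apply/eqP; rewrite {1}sE; field; rewrite gt_eqF.
Qed.

End sequences_of_reals.

(** * Expectations of functions of exponential growth *)

Section tame_functions.
Context (R : realType).
Implicit Types f g : R -> R.

(** A class of test functions closed under the algebraic operations, containing
    powers, exponentials, cosines and indicators of intervals, and integrable
    against every law with exponential moments. *)
Definition tame g := measurable_fun setT g /\
  exists A B, [/\ 0 <= A, 0 <= B & forall y, `|g y| <= A * expR (B * `|y|)].

Lemma tame_bounded g A : measurable_fun setT g -> (forall y, `|g y| <= A) ->
  tame g.
Proof.
move=> mg gA; split=> //; exists A, 0; split=> // [|y].
  exact: le_trans (gA 0).
by rewrite mul0r expR0 mulr1.
Qed.

Lemma tame_cst c : tame (cst c).
Proof. by apply: (@tame_bounded _ `|c|). Qed.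

Lemma tameD f g : tame f -> tame g -> tame (fun y => f y + g y).
Proof.
move=> [mf [A [B [A0 B0 fAB]]]] [mg [A' [B' [A0' B0' gAB]]]].
split; first exact: measurable_funD.
exists (A + A'), (B + B'); split; rewrite ?addr_ge0// => y.
apply: (le_trans (ler_normD _ _)); rewrite mulrDl lerD//.
  apply: (le_trans (fAB y)); rewrite ler_wpM2l// ler_expR ler_wpM2r//.
  by rewrite lerDl.
apply: (le_trans (gAB y)); rewrite ler_wpM2l// ler_expR ler_wpM2r//.
by rewrite lerDr.
Qed.

Lemma tameM f g : tame f -> tame g -> tame (fun y => f y * g y).
Proof.
move=> [mf [A [B [A0 B0 fAB]]]] [mg [A' [B' [A0' B0' gAB]]]].
split; first exact: measurable_funM.
exists (A * A'), (B + B'); split; rewrite ?addr_ge0 ?mulr_ge0// => y.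
by rewrite normrM mulrDl expRD mulrACA ler_pM.
Qed.

Lemma tameZ c g : tame g -> tame (fun y => c * g y).
Proof. exact/tameM/tame_cst. Qed.

Lemma tameB f g : tame f -> tame g -> tame (fun y => f y - g y).
Proof.
move=> tf tg; rewrite (_ : (fun y => _) = (fun y => f y + -1 * g y)).
  by apply: tameD => //; exact: tameZ.
by apply/funext => y; rewrite mulN1r.
Qed.

Lemma tame_sum (I : Type) (l : seq I) (F : I -> R -> R) :
  (forall i, tame (F i)) -> tame (fun y => \sum_(i <- l) F i y).
Proof.
move=> tF; elim: l => [|i l IH].
  by under eq_fun do rewrite big_nil; exact: tame_cst.
by under eq_fun do rewrite big_cons; exact: tameD.
Qed.

Lemma tame_id : tame id.
Proof.
split; first exact: measurable_id.
exists 1, 1; split=> // y; rewrite !mul1r.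
by apply: le_trans (expR_ge1Dx _); rewrite lerDr.
Qed.

Lemma tameX g m : tame g -> tame (fun y => g y ^+ m).
Proof.
move=> tg; elim: m => [|m IH]; first exact: (tame_cst 1).
by under eq_fun do rewrite exprS; exact: tameM.
Qed.

Lemma tame_norm g : tame g -> tame (fun y => `|g y|).
Proof.
move=> [mg [A [B [A0 B0 gAB]]]]; split; first exact: measurableT_comp.
by exists A, B; split=> // y; rewrite normr_id.
Qed.

Lemma tame_opp g : tame g -> tame (fun y => g (- y)).
Proof.
move=> [mg [A [B [A0 B0 gAB]]]]; split.
  by apply: measurableT_comp => //; exact: measurable_oppr.
by exists A, B; split=> // y; rewrite -(normrN y).
Qed.

Lemma tame_expR s : tame (fun y => expR (s * y)).
Proof.
split; first by apply: measurableT_comp => //; exact: measurable_funM.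
exists 1, `|s|; split=> // y; rewrite mul1r ger0_norm ?expR_ge0//.
by rewrite ler_expR -normrM ler_norm.
Qed.

Lemma tame_expR_norm c : 0 <= c -> tame (fun y => expR (c * `|y|)).
Proof.
move=> c0; split.
  by apply: measurableT_comp => //; apply: measurable_funM => //.
by exists 1, c; split=> // y; rewrite mul1r ger0_norm ?expR_ge0.
Qed.

Lemma tame_cos t : tame (fun y => cos (t * y)).
Proof.
apply: (@tame_bounded _ 1) => [|y]; last exact: cos_max.
apply: measurableT_comp; last exact: measurable_funM.
by apply: continuous_measurable_fun; exact: continuous_cos.
Qed.

Lemma tame_bool (b : R -> bool) : measurable_fun setT b ->
  tame (fun y => (b y)%:R).
Proof.
move=> mb; apply: (@tame_bounded _ 1) => [|y]; last first.
  by case: (b y); rewrite ?normr1 ?normr0.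
rewrite (_ : (fun y => _) = (fun y => if b y then 1 else 0)).
  exact: measurable_fun_if.
by apply/funext => y; case: (b y).
Qed.

Lemma tame_ler x : tame (fun y => (y <= x)%R%:R).
Proof. by apply: tame_bool; exact: measurable_fun_ler. Qed.

Lemma tame_ltr_norm x : tame (fun y => (x < `|y|)%R%:R).
Proof. by apply: tame_bool; apply: measurable_fun_ltr => //; exact: measurableT_comp. Qed.

Lemma tame_ler_norm x : tame (fun y => (`|y| <= x)%R%:R).
Proof. by apply: tame_bool; apply: measurable_fun_ler => //; exact: measurableT_comp. Qed.

Lemma tame_norm_ltr x : tame (fun y => (`|y| < x)%R%:R).
Proof. by apply: tame_bool; apply: measurable_fun_ltr => //; exact: measurableT_comp. Qed.

End tame_functions.

Section mean.
Context d (T : measurableType d) (R : realType) (P : probability T R).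
Implicit Types (f g : R -> R) (Y : {RV P >-> R}).

Definition mean (Y : T -> R) g : R := \int[P]_t g (Y t).

Definition light_tailed (Y : T -> R) :=
  forall s, P.-integrable setT (EFin \o (fun t => expR (s * Y t))).

Lemma tame_integrable Y g : light_tailed Y -> tame g ->
  P.-integrable setT (EFin \o (fun t => g (Y t))).
Proof.
move=> lY [mg [A [B [A0 B0 gAB]]]].
have i1 : P.-integrable setT
    (EFin \o (fun t => A * (expR (B * Y t) + expR (- B * Y t)))).
  rewrite (_ : EFin \o _ = (fun t => A%:E *
     ((EFin \o (fun t => expR (B * Y t))) \+
      (EFin \o (fun t => expR (- B * Y t)))) t)%E).
    by apply: integrableZl => //; exact: integrableD.
  by apply/funext.
apply: le_integrable i1 => //.
  by apply/measurable_EFinP; exact: measurableT_comp.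
move=> t _ /=; rewrite lee_fin.
have e0 : 0 <= expR (B * Y t) + expR (- B * Y t) by rewrite addr_ge0 ?expR_ge0.
rewrite [leRHS]ger0_norm ?mulr_ge0//; apply: (le_trans (gAB _)).
rewrite ler_wpM2l//; have [Y0|Y0] := ger0P (Y t).
  by rewrite lerDl expR_ge0.
by rewrite mulNr -mulrN lerDr expR_ge0.
Qed.

Lemma mean_cst Y c : mean Y (cst c) = c.
Proof. rewrite /mean Rintegral_cst// [X in c * fine X](_ : _ = 1%E) ?mulr1//.
exact: probability_setT. Qed.

Lemma eq_mean Y f g : f =1 g -> mean Y f = mean Y g.
Proof. by move=> fg; apply: eq_Rintegral => t _. Qed.

Section light_tailed_mean.
Context Y (lY : light_tailed Y).

Lemma meanD f g : tame f -> tame g ->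
  mean Y (fun y => f y + g y) = mean Y f + mean Y g.
Proof. by move=> tf tg; apply: RintegralD => //; exact: tame_integrable. Qed.

Lemma meanZ c g : tame g -> mean Y (fun y => c * g y) = c * mean Y g.
Proof. by move=> tg; apply: RintegralZl => //; exact: tame_integrable. Qed.

Lemma meanB f g : tame f -> tame g ->
  mean Y (fun y => f y - g y) = mean Y f - mean Y g.
Proof. by move=> tf tg; apply: RintegralB => //; exact: tame_integrable. Qed.

Lemma mean_sum (I : Type) (l : seq I) (F : I -> R -> R) :
  (forall i, tame (F i)) ->
  mean Y (fun y => \sum_(i <- l) F i y) = \sum_(i <- l) mean Y (F i).
Proof.
move=> tF; elim: l => [|i l IH].
  rewrite big_nil (@eq_mean _ _ (cst 0)) ?mean_cst// => y.
  by rewrite big_nil.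
rewrite big_cons -IH -meanD//; last exact: tame_sum.
by apply: eq_mean => y; rewrite big_cons.
Qed.

Lemma mean_le f g : tame f -> tame g -> (forall y, f y <= g y) ->
  mean Y f <= mean Y g.
Proof.
by move=> tf tg fg; apply: le_Rintegral => //; exact: tame_integrable.
Qed.

Lemma mean_ge0 g : (forall y, 0 <= g y) -> 0 <= mean Y g.
Proof. by move=> g0; apply: Rintegral_ge0. Qed.

Lemma norm_mean_le g f : tame g -> tame f -> (forall y, `|g y| <= f y) ->
  `|mean Y g| <= mean Y f.
Proof.
move=> tg tf gf.
apply: (@le_trans _ _ (mean Y (fun y => `|g y|))).
  by apply: le_normr_Rintegral => //; exact: tame_integrable.
by apply: mean_le => //; exact: tame_norm.
Qed.

Lemma momentE m : moment P m Y = (mean Y (fun y => y ^+ m))%:E.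
Proof.
rewrite /moment unlock /mean /Rintegral fineK//.
apply: integrable_fin_num => //.
apply: (@tame_integrable _ (fun y => y ^+ m)) => //.
by apply: tameX; exact: tame_id.
Qed.

Lemma cdfE x : cdf Y x = (mean Y (fun y => (y <= x)%R%:R))%:E.
Proof.
rewrite /mean /Rintegral fineK; last first.
  apply: integrable_fin_num => //.
  by apply: (@tame_integrable _ (fun y => (y <= x)%R%:R)) => //; exact: tame_ler.
rewrite /cdf /distribution /pushforward.
rewrite (_ : Y @^-1` _ = [set t | Y t <= x]); last first.
  by apply/seteqP; split => t /=; rewrite in_itv.
transitivity (\int[P]_t (\1_[set t | Y t <= x] t)%:E)%E; last first.
  by apply: eq_integral => t _; rewrite indicE mem_setE.
rewrite integral_indic//= ?setIT//.
have mb : measurable_fun setT (fun t => Y t <= x) by exact: measurable_fun_ler.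
have := mb measurableT [set true] I.
by rewrite setTI.
Qed.

(** Taylor formula for the moment generating function; the remainder is controlled
    by an exponential moment that does not depend on [K]. *)
Lemma mgf_taylor (K : nat) s : 0 < s <= 1 ->
  `|mean Y (fun y => expR (s * y))
      - \sum_(k < K) mean Y (fun y => y ^+ k) / k`!%:R * s ^+ k|
    <= mean Y (fun y => expR (1 * `|y|)) * s ^+ K.
Proof.
case/andP => s0 s1.
have tX k : tame (fun y : R => s ^+ k / k`!%:R * y ^+ k).
  by apply: tameZ; apply: tameX; exact: tame_id.
have -> : \sum_(k < K) mean Y (fun y => y ^+ k) / k`!%:R * s ^+ k =
    mean Y (fun y => \sum_(k < K) s ^+ k / k`!%:R * y ^+ k).
  rewrite mean_sum//; apply: eq_bigr => k _.
  by rewrite meanZ; [ring|apply: tameX; exact: tame_id].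
rewrite -meanB; [|exact: tame_expR|exact: tame_sum].
rewrite mulrC -meanZ; last exact: tame_expR_norm.
apply: norm_mean_le => [||y].
- by apply: tameB; [exact: tame_expR|exact: tame_sum].
- by apply: tameZ; exact: tame_expR_norm.
- have := expR_tail (s * y) K s0 s1.
  rewrite normrM (gtr0_norm s0) mulrAC divff ?gt_eqF//.
  rewrite (eq_bigr (fun k : 'I_K => s ^+ k / k`!%:R * y ^+ k))//.
  by move=> k _; rewrite exprMn mulrAC.
Qed.

(** Here [t] is arbitrary, and a small [r] makes the remainder small as [K]
    grows, at the cost of an exponential moment of higher order. *)
Lemma mean_cos_taylor (K : nat) t r : 0 < r <= 1 ->
  `|mean Y (fun y => cos (t * y))
      - \sum_(k < K) cos_sign R k * (t ^+ k / k`!%:R) * mean Y (fun y => y ^+ k)|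
    <= r ^+ K * mean Y (fun y => expR (`|t| / r * `|y|)).
Proof.
case/andP => r0 r1.
have tr0 : 0 <= `|t| / r by rewrite divr_ge0// ltW.
have tX k : tame (fun y : R => cos_sign R k * (t ^+ k / k`!%:R) * y ^+ k).
  by apply: tameZ; apply: tameX; exact: tame_id.
rewrite (eq_bigr (fun k : 'I_K =>
    mean Y (fun y => cos_sign R k * (t ^+ k / k`!%:R) * y ^+ k))); last first.
  by move=> k _; rewrite meanZ//; apply: tameX; exact: tame_id.
rewrite -mean_sum// -meanB; [|exact: tame_cos|exact: tame_sum].
rewrite -meanZ; last exact: tame_expR_norm.
apply: norm_mean_le => [||y].
- by apply: tameB; [exact: tame_cos|exact: tame_sum].
- by apply: tameZ; exact: tame_expR_norm.
- have := cos_tail (t * y) K r0 r1.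
  rewrite normrM mulrAC.
  rewrite (eq_bigr (fun k : 'I_K => cos_sign R k * (t ^+ k / k`!%:R) * y ^+ k))//.
  by move=> k _; rewrite exprMn; ring.
Qed.

Lemma mean_expR_norm_le c : 0 <= c ->
  mean Y (fun y => expR (c * `|y|))
    <= mean Y (fun y => expR (c * y)) + mean Y (fun y => expR (- c * y)).
Proof.
move=> c0; rewrite -meanD; [|exact: tame_expR|exact: tame_expR].
apply: mean_le => [||y]; first exact: tame_expR_norm.
  by apply: tameD; exact: tame_expR.
have [y0|y0] := ger0P y; first by rewrite lerDl expR_ge0.
by rewrite mulNr -mulrN lerDr expR_ge0.
Qed.

End light_tailed_mean.
End mean.

(** * From moment generating functions to laws *)

(** Uniform approximation of the indicator of [|y| <= x] by polynomials in
    [cos(t y)]. For small [t], [cos(t y)] is a decreasing function of [|y|] on a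
    long interval [[0, M]] with [t M = pi], so a polynomial step in
    [u = (1 - cos(t y)) / 2] does it there. Periodicity spoils the approximation
    beyond [M], where [1 <= e y^2]. *)
Lemma cos_step (R : realType) (x x' e : R) : 0 < x -> x < x' -> 0 < e ->
  exists (t : R) (p : {poly R}), forall y,
    (`|y| <= x)%R%:R <= p.[cos (t * y)] + e /\
    p.[cos (t * y)] <= (`|y| < x')%R%:R + e + e * y ^+ 2.
Proof.
move=> x0 xx' e0.
pose M := x' + 1 + e^-1.
have x'0 : 0 < x' := lt_trans x0 xx'.
have ei0 : 0 < e^-1 by rewrite invr_gt0.
have M1 : 1 <= M by rewrite /M; lra.
have M0 : 0 < M by lra.
have eM : 1 <= e * M ^+ 2.
  have : 1 <= e * M.
    by rewrite /M mulrDr mulrDr divff ?gt_eqF// lerDr addr_ge0// mulr_ge0// ltW.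
  by rewrite expr2 mulrA => eM; rewrite mulr_ege1.
pose t := pi / M : R.
have t0 : 0 < t by rewrite divr_gt0// pi_gt0.
have tM : t * M = pi by rewrite divfK// gt_eqF.
have in0pi w : 0 <= w <= M -> t * w \in `[0, pi].
  case/andP=> w0 wM; rewrite in_itv/= mulr_ge0 ?(ltW t0)//=.
  by rewrite -tM ler_pM2l.
have cos_mono w w' : 0 <= w <= M -> 0 <= w' <= M ->
    (cos (t * w') <= cos (t * w)) = (w <= w').
  by move=> w0 w0'; rewrite leNgt ltr_cos ?in0pi// -leNgt ler_pM2l.
have xM : 0 <= x <= M by rewrite (ltW x0)/= /M; lra.
have x'M : 0 <= x' <= M by rewrite (ltW x'0)/= /M; lra.
have zM : 0 <= (0 : R) <= M by rewrite lexx ltW.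
pose a := (1 - cos (t * x)) / 2; pose b := (1 - cos (t * x')) / 2.
have c0x : cos (t * x) < 1.
  by rewrite -[ltRHS]cos0 -(mulr0 t) ltNge cos_mono// -ltNge.
have cxx' : cos (t * x') < cos (t * x) by rewrite ltNge cos_mono// -ltNge.
have a0 : 0 < a by rewrite divr_gt0// subr_gt0.
have ab : a < b by rewrite ltr_pM2r// ltrD2l ltrN2.
have b1 : b <= 1 by rewrite ler_pdivrMr// mul1r; have := cos_geN1 (t * x'); lra.
have [m [N step]] := step_poly a0 ab b1 e0.
exists t, ((1 - (2^-1 *: (1 - 'X)) ^+ m) ^+ N) => y.
pose u := (1 - cos (t * y)) / 2.
have u01 : 0 <= u <= 1.
  have := cos_geN1 (t * y); have := cos_le1 (t * y); rewrite /u.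
  by move=> *; apply/andP; split; lra.
have -> : ((1 - (2^-1 *: (1 - 'X)) ^+ m) ^+ N).[cos (t * y)] = (1 - u ^+ m) ^+ N.
  by rewrite !hornerE /u mulrC.
have cosy : cos (t * y) = cos (t * `|y|).
  by rewrite -[LHS]cos_norm normrM (gtr0_norm t0).
have [/andP[q0 q1] qa qb] := step u u01.
have ey0 : 0 <= e * y ^+ 2 by rewrite mulr_ge0 ?sqr_ge0// ltW.
split.
  case: (leP `|y| x) => yx; last by rewrite addr_ge0// ltW.
  rewrite -lerBlDr; apply: qa; rewrite /u /a ler_pM2r// lerD2l lerN2 cosy.
  by rewrite cos_mono ?normr_ge0// (le_trans yx)//; case/andP: xM.
case: (ltP `|y| x') => yx.
  by rewrite -addrA; apply: (le_trans q1); rewrite lerDl addr_ge0// ltW.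
rewrite add0r; have [yM|My] := leP `|y| M.
  apply: (@le_trans _ _ e); last by rewrite lerDl.
  apply: qb; rewrite /u /b ler_pM2r// lerD2l lerN2 cosy.
  by rewrite cos_mono ?normr_ge0.
apply: (le_trans q1); apply: (le_trans eM); rewrite -[leLHS]add0r lerD ?(ltW e0)//.
by rewrite ler_pM2l// -(real_normK (num_real y)) lerXn2r ?nnegrE ?(ltW M0) ?(ltW My).
Qed.

Section powers_of_cos.
Context d (T : measurableType d) (R : realType) (P : probability T R).
Context (Y : {RV P >-> R}) (lY : light_tailed P Y).

Lemma tame_cosX (t a : R) j : tame (fun y => cos (t * y) ^+ j * cos (a * y)).
Proof. by apply: tameM; [apply: tameX|]; exact: tame_cos. Qed.

(** Product to sum formula: products of cosines are combinations of cosines. *)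
Lemma mean_cosXS t a j :
  mean P Y (fun y => cos (t * y) ^+ j.+1 * cos (a * y)) =
  2^-1 * (mean P Y (fun y => cos (t * y) ^+ j * cos ((a + t) * y))
        + mean P Y (fun y => cos (t * y) ^+ j * cos ((a - t) * y))).
Proof.
rewrite -meanD; [|exact: lY|exact: tame_cosX|exact: tame_cosX].
rewrite -meanZ//; last by apply: tameD; exact: tame_cosX.
apply: eq_mean => y; rewrite mulrDl mulrBl cosD cosB exprS.
by field.
Qed.

Lemma mean_poly_cosE t (p : {poly R}) :
  mean P Y (fun y => p.[cos (t * y)]) =
  \sum_(i < size p) p`_i * mean P Y (fun y => cos (t * y) ^+ i * cos (0 * y)).
Proof.
transitivity (mean P Y (fun y => \sum_(i < size p)
    p`_i * (cos (t * y) ^+ i * cos (0 * y)))).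
  apply: eq_mean => y; rewrite horner_coef; apply: eq_bigr => i _.
  by rewrite mul0r cos0 mulr1.
rewrite mean_sum//; last by move=> i; apply: tameZ; exact: tame_cosX.
by apply: eq_bigr => i _; rewrite meanZ//; exact: tame_cosX.
Qed.

Lemma tame_poly_cos t (p : {poly R}) : tame (fun y => p.[cos (t * y)]).
Proof.
under eq_fun do rewrite horner_coef.
by apply: tame_sum => i; apply: tameZ; apply: tameX; exact: tame_cos.
Qed.

End powers_of_cos.

Section law_of_mgf.
Context (R : realType) (d : nat -> measure_display)
  (T : forall n, measurableType (d n)) (P : forall n, probability (T n) R)
  (Y : forall n, {RV P n >-> R})
  (d' : measure_display) (T' : measurableType d') (Q : probability T' R)
  (Z : {RV Q >-> R}).
Hypothesis lY : forall n, light_tailed (P n) (Y n).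
Hypothesis lZ : light_tailed Q Z.

Section mgf_cvg.
Hypothesis mgf_cvg : forall s,
  mean (P n) (Y n) (fun y => expR (s * y)) @[n --> \oo]
    --> mean Q Z (fun y => expR (s * y)).

Lemma expR_norm_bounded (c : R) : 0 <= c ->
  exists2 C, mean Q Z (fun y => expR (c * `|y|)) <= C &
  \forall n \near \oo, mean (P n) (Y n) (fun y => expR (c * `|y|)) <= C.
Proof.
move=> c0.
pose L n := mean (P n) (Y n) (fun y => expR (c * y))
  + mean (P n) (Y n) (fun y => expR (- c * y)).
pose L' := mean Q Z (fun y => expR (c * y)) + mean Q Z (fun y => expR (- c * y)).
have cL : L n @[n --> \oo] --> L' by apply: cvgD.
exists (L' + 1).
  by apply: (le_trans (mean_expR_norm_le lZ c0)); rewrite lerDl.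
have L1 : L' < L' + 1 by rewrite ltrDl.
have LL1 : \forall n \near \oo, L n <= L' + 1 by apply: (cvgr_le _ cL).
near=> n; apply: (@le_trans _ _ (L n)); first exact: mean_expR_norm_le.
by near: n.
Unshelve. all: by end_near. Qed.

(** The moments are the Taylor coefficients of the moment generating function, up
    to factorials. *)
Lemma mean_power_cvg k :
  mean (P n) (Y n) (fun y => y ^+ k) @[n --> \oo] --> mean Q Z (fun y => y ^+ k).
Proof.
have [C ZC YC] := expR_norm_bounded ler01.
pose a n k := mean (P n) (Y n) (fun y => y ^+ k) / k`!%:R.
pose b k := mean Q Z (fun y => y ^+ k) / k`!%:R.
have : a n k @[n --> \oo] --> b k.
  apply: (@coef_cvg _ k.+1 a b
    (fun n s => mean (P n) (Y n) (fun y => expR (s * y)))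
    (fun s => mean Q Z (fun y => expR (s * y))) C) => //.
  - near=> n => K s _ s01; apply: (le_trans (mgf_taylor (lY n) K s01)).
    rewrite ler_wpM2r ?exprn_ge0//; first by case/andP : s01 => /ltW.
    by near: n.
  - move=> K s _ s01; apply: (le_trans (mgf_taylor lZ K s01)).
    by rewrite ler_wpM2r ?exprn_ge0//; case/andP : s01 => /ltW.
move=> /(cvgMl (b := k`!%:R)).
rewrite /b divfK ?pnatr_eq0 -?lt0n ?fact_gt0//.
apply: cvg_trans; apply: near_eq_cvg; near=> n.
by rewrite /a divfK// pnatr_eq0 -lt0n fact_gt0.
Unshelve. all: by end_near. Qed.

(** Truncate the cosine series at an order that is uniform in [n], and use the
    convergence of moments on the truncation. *)
Lemma mean_cos_cvg t :
  mean (P n) (Y n) (fun y => cos (t * y)) @[n --> \oo]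
    --> mean Q Z (fun y => cos (t * y)).
Proof.
have c0 : 0 <= `|t| / 2^-1 by rewrite divr_ge0.
have [C ZC YC] := expR_norm_bounded c0.
have C0 : 0 <= C by apply: le_trans ZC; apply: mean_ge0 => y; exact: expR_ge0.
apply/cvgrPdist_le => e e0.
have e30 : 0 < e / 3 by rewrite divr_gt0.
have [K hK] : exists K : nat, (2^-1 : R) ^+ K * C <= e / 3.
  have q1 : `|2^-1 : R| < 1 by rewrite ger0_norm// invf_lt1// ltr1n.
  have := cvg_expr q1 => /(cvgMl (b := C)); rewrite mul0r.
  move=> /cvgr0Pnorm_le /(_ _ e30)[N _ /(_ N (leqnn _))] H.
  by exists N; apply: le_trans (ler_norm _) H.
have half1 : 0 < (2^-1 : R) <= 1 by rewrite invr_gt0 ltr0n/= invf_le1// ler1n.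
pose S (f : nat -> R) := \sum_(k < K) cos_sign R k * (t ^+ k / k`!%:R) * f k.
have cS : S (fun k => mean (P n) (Y n) (fun y => y ^+ k)) @[n --> \oo] -->
    S (fun k => mean Q Z (fun y => y ^+ k)).
  by apply: cvg_sumr => k; apply: cvgMr; exact: mean_power_cvg.
move/cvgrPdist_le : cS => /(_ _ e30) cS.
near=> n.
have hS : `|S (fun k => mean Q Z (fun y => y ^+ k))
   - S (fun k => mean (P n) (Y n) (fun y => y ^+ k))| <= e / 3 by near: n.
have hY := mean_cos_taylor (lY n) K t half1.
have hZ := mean_cos_taylor lZ K t half1.
have YCn : mean (P n) (Y n) (fun y => expR (`|t| / 2^-1 * `|y|)) <= C by near: n.
have p0 : 0 <= (2^-1 : R) ^+ K by rewrite exprn_ge0.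
have hY' := le_trans (le_trans hY (ler_wpM2l p0 YCn)) hK.
have hZ' := le_trans (le_trans hZ (ler_wpM2l p0 ZC)) hK.
set z := mean Q Z _ in hZ' *; set w := mean (P n) (Y n) _ in hY' *.
set sz := S _ in hS; set sw := S _ in hS.
rewrite (_ : z - w = (z - sz) + (sz - sw) - (w - sw)); last by ring.
apply: (le_trans (ler_normB _ _)); apply: (@le_trans _ _ (e / 3 + e / 3 + e / 3)).
  by rewrite lerD//; apply: (le_trans (ler_normD _ _)); rewrite lerD.
by lra.
Unshelve. all: by end_near. Qed.

Lemma mean_cosX_cvg t j a :
  mean (P n) (Y n) (fun y => cos (t * y) ^+ j * cos (a * y)) @[n --> \oo]
    --> mean Q Z (fun y => cos (t * y) ^+ j * cos (a * y)).
Proof.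
elim: j a => [|j IH] a.
  have -> : (fun y : R => cos (t * y) ^+ 0 * cos (a * y)) = (fun y => cos (a * y)).
    by apply/funext => y; rewrite expr0 mul1r.
  exact: mean_cos_cvg.
rewrite mean_cosXS//.
under eq_fun do rewrite mean_cosXS//.
by apply: cvgMr; exact: cvgD.
Qed.

Lemma mean_poly_cos_cvg t (p : {poly R}) :
  mean (P n) (Y n) (fun y => p.[cos (t * y)]) @[n --> \oo]
    --> mean Q Z (fun y => p.[cos (t * y)]).
Proof.
rewrite mean_poly_cosE//; under eq_fun do rewrite mean_poly_cosE//.
by apply: cvg_sumr => i; apply: cvgMr; exact: mean_cosX_cvg.
Qed.

(** The convergence of the expectations of the polynomials in [cos(t y)] of
    [cos_step], together with bounded second moments to pay for their values at
    infinity. The gap between [x] and [x'] is the price of approximating an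
    indicator by continuous functions. *)
Lemma norm_law_squeeze (x x' e : R) : 0 < x -> x < x' -> 0 < e ->
  \forall n \near \oo,
    mean (P n) (Y n) (fun y => (`|y| <= x)%R%:R)
      <= mean Q Z (fun y => (`|y| < x')%R%:R) + e /\
    mean Q Z (fun y => (`|y| <= x)%R%:R) - e
      <= mean (P n) (Y n) (fun y => (`|y| < x')%R%:R).
Proof.
move=> x0 xx' e0.
pose m2 := mean Q Z (fun y => y ^+ 2).
have m20 : 0 <= m2 by apply: mean_ge0 => y; exact: sqr_ge0.
pose u := e / (4 + m2).
have u0 : 0 < u by rewrite divr_gt0// ltr_pwDl.
have ue : 4 * u + u * m2 = e.
  by rewrite -[RHS](@divfK _ (4 + m2)) ?gt_eqF ?ltr_pwDl// -/u; ring.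
have [t [p hp]] := cos_step x0 xx' u0.
have tle z : tame (fun y : R => (`|y| <= z)%R%:R) by exact: tame_ler_norm.
have tlt z : tame (fun y : R => (`|y| < z)%R%:R) by exact: tame_norm_ltr.
have tp : tame (fun y => p.[cos (t * y)]) by exact: tame_poly_cos.
have tX : tame (fun y : R => y ^+ 2) by apply: tameX; exact: tame_id.
have bounds d0 (T0 : measurableType d0) (P0 : probability T0 R) (W : {RV P0 >-> R}) :
    light_tailed P0 W ->
    mean P0 W (fun y => (`|y| <= x)%R%:R) <= mean P0 W (fun y => p.[cos (t * y)]) + u /\
    mean P0 W (fun y => p.[cos (t * y)])
      <= mean P0 W (fun y => (`|y| < x')%R%:R) + u + u * mean P0 W (fun y => y ^+ 2).
  move=> lW; have tu := tame_cst u; have tuX := tameZ u tX.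
  have tltu := tameD (tlt x') tu.
  split; [rewrite -[X in _ + X](mean_cst W u)|rewrite -[X in _ + X + _](mean_cst W u)].
    rewrite -(meanD lW tp tu); apply: mean_le => // [|y]; last by case: (hp y).
    exact: tameD.
  rewrite -(meanD lW (tlt x') tu) -(meanZ lW u tX) -(meanD lW tltu tuX).
  by apply: mean_le => // [|y]; [exact: tameD|case: (hp y)].
have [Z1 Z2] := bounds _ _ _ Z lZ.
have cp := @mean_poly_cos_cvg t p.
have c2 := @mean_power_cvg 2.
move/cvgrPdist_le : cp => /(_ _ u0) cp.
have c2' : \forall n \near \oo, mean (P n) (Y n) (fun y => y ^+ 2) <= m2 + 1.
  by apply: (cvgr_le _ c2); rewrite ltrDl.
near=> n.
have [Y1 Y2] := bounds _ _ _ (Y n) (lY n).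
have dn : `|mean Q Z (fun y => p.[cos (t * y)])
   - mean (P n) (Y n) (fun y => p.[cos (t * y)])| <= u by near: n.
have m2n : mean (P n) (Y n) (fun y => y ^+ 2) <= m2 + 1 by near: n.
have um : u * mean (P n) (Y n) (fun y => y ^+ 2) <= u * m2 + u.
  by rewrite -[X in _ + X]mulr1 -mulrDr ler_pM2l.
have um0 : 0 <= u * m2 by rewrite mulr_ge0// ltW.
move: dn; rewrite ler_norml => /andP[dn1 dn2].
by split; move: Z1 Z2 Y1 Y2; rewrite -/m2; lra.
Unshelve. all: by end_near. Qed.

End mgf_cvg.

Local Notation F n x := (mean (P n) (Y n) (fun y => (y <= x)%R%:R)).
Local Notation FZ x := (mean Q Z (fun y => (y <= x)%R%:R)).

(** The continuity of the limit distribution function at [x] in terms of real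
    numbers. *)
Lemma cvg_cdfP :
  cvg_in_distribution Y Z <->
  forall x : R, (forall e : R, 0 < e -> exists2 r, 0 < r &
      forall y, `|y - x| <= r -> `|FZ y - FZ x| <= e) ->
    F n x @[n --> \oo] --> FZ x.
Proof.
split=> H x cx.
  have -> : (fun n => F n x) = (fun n => fine (cdf (Y n) x)).
    by apply/funext => n; rewrite cdfE.
  apply: fine_cvg; rewrite -cdfE//; apply: H.
  rewrite /continuous_at (_ : cdf Z = EFin \o (fun y => FZ y)); last first.
    by apply/funext => y; rewrite cdfE.
  apply: cvg_EFin; first by near=> y.
  apply/cvgrPdist_le => e e0; have [r r0 xr] := cx e e0.
  near=> y; rewrite distrC; apply: xr; near: y.
  by apply: (cvgr_distC_le); [exact: cvg_id|].
have E n : cdf (Y n) x = (F n x)%:E by rewrite cdfE.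
rewrite cdfE//; under eq_fun do rewrite E.
apply: cvg_EFin; first by near=> n.
apply: H => e e0.
have : {for x, continuous (fun y => FZ y)}.
  rewrite /continuous_at.
  have -> : (fun y => FZ y) = fine \o cdf Z.
    by apply/funext => y /=; rewrite cdfE.
  by apply: fine_cvg; rewrite -cdfE.
move=> /cvgrPdist_le/(_ _ e0)/nbhs_ballP[r /= r0 xr].
exists (r / 2); first by rewrite divr_gt0.
move=> y yx; rewrite distrC; apply: xr; rewrite /ball/= distrC.
by apply: (le_lt_trans yx); rewrite ltr_pdivrMr// ltr_pMr// ltr1n.
Unshelve. all: by end_near. Qed.

End law_of_mgf.

Section symmetric_laws.
Context d (T : measurableType d) (R : realType) (P : probability T R).

Definition symmetric_law (Y : T -> R) := forall x,
  mean P Y (fun y => (y <= x)%R%:R) = mean P Y (fun y => (- y <= x)%R%:R).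

Context (Y : {RV P >-> R}) (lY : light_tailed P Y) (sY : symmetric_law Y).
Local Notation F x := (mean P Y (fun y => (y <= x)%R%:R)).

(* For a symmetric law the distribution function is a function of the law of the
   absolute value. *)
Let F_sym (x : R) : 2 * F x = mean P Y (fun y => (y <= x)%R%:R + (- y <= x)%R%:R).
Proof.
rewrite meanD//; [|exact: tame_ler|exact: tame_opp (tame_ler x)].
by rewrite -sY; ring.
Qed.

Lemma cdf_norm_le (x : R) : 0 <= x -> 2 * F x = 1 + mean P Y (fun y => (`|y| <= x)%R%:R).
Proof.
move=> x0; rewrite F_sym -[X in X + _](mean_cst Y 1) -(meanD lY (tame_cst 1) (tame_ler_norm x)).
apply: eq_mean => y; rewrite ler_norml /cst lerNl.
by case: (leP y x); case: (leP (- x) y) => //=; rewrite ?addr0 ?add0r//; lra.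
Qed.

Lemma cdf_norm_lt (x : R) : 0 < x -> 2 * F (- x) = 1 - mean P Y (fun y => (`|y| < x)%R%:R).
Proof.
move=> x0; rewrite F_sym -[X in X - _](mean_cst Y 1) -(meanB lY (tame_cst 1) (tame_norm_ltr x)).
apply: eq_mean => y; rewrite ltr_norml /cst lerN2.
by case: (leP y (- x)); case: (leP x y) => //=; rewrite ?addr0 ?add0r ?subr0 ?subrr//; lra.
Qed.

Lemma tail_norm (x : R) : 0 <= x -> mean P Y (fun y => (x < `|y|)%R%:R) = 2 - 2 * F x.
Proof.
move=> x0; rewrite cdf_norm_le// opprD addrA.
rewrite (_ : 2 - 1 = 1) -?[X in X - _](mean_cst Y 1); last by lra.
rewrite -(meanB lY (tame_cst 1) (tame_ler_norm x)).
by apply: eq_mean => y; rewrite /cst; case: leP; rewrite ?subrr ?subr0.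
Qed.

Lemma cdfr_le (x y : R) : x <= y -> F x <= F y.
Proof.
move=> xy; apply: mean_le => //; [exact: tame_ler|exact: tame_ler|move=> z].
by rewrite ler_nat; case: leP => //= zx; rewrite (le_trans zx).
Qed.

Lemma norm_lt_le (x : R) : mean P Y (fun y => (`|y| < x)%R%:R) <= mean P Y (fun y => (`|y| <= x)%R%:R).
Proof.
apply: mean_le => //; [exact: tame_norm_ltr|exact: tame_ler_norm|move=> z].
by rewrite ler_nat; case: ltP => //= /ltW ->.
Qed.

End symmetric_laws.

Section symmetric_convergence.
Context (R : realType) (d : nat -> measure_display)
  (T : forall n, measurableType (d n)) (P : forall n, probability (T n) R)
  (Y : forall n, {RV P n >-> R})
  (d' : measure_display) (T' : measurableType d') (Q : probability T' R)
  (Z : {RV Q >-> R}).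
Hypothesis lY : forall n, light_tailed (P n) (Y n).
Hypothesis lZ : light_tailed Q Z.
Hypothesis sY : forall n, symmetric_law (P n) (Y n).
Hypothesis sZ : symmetric_law Q Z.
Local Notation F n x := (mean (P n) (Y n) (fun y => (y <= x)%R%:R)).
Local Notation FZ x := (mean Q Z (fun y => (y <= x)%R%:R)).

(** Curtiss's theorem, for symmetric laws: the distribution function at [x]
    depends only on the law of the absolute value near [|x|], to which
    [norm_law_squeeze] applies. *)
Theorem cvg_in_distribution_of_mgf :
  (forall s, mean (P n) (Y n) (fun y => expR (s * y)) @[n --> \oo]
    --> mean Q Z (fun y => expR (s * y))) ->
  cvg_in_distribution Y Z.
Proof.
move=> cmgf.
(* The condition 0 < x x' asks for two nonzero points on the same side of 0, so
   that |x| and |x'| lie on a common positive interval. *)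
have squeeze (x x' e : R) : x < x' -> 0 < x * x' -> 0 < e ->
    \forall n \near \oo, F n x <= FZ x' + e /\ FZ x - e <= F n x'.
  move=> xx' pxx' e0.
  have [x0|x0] := ltP 0 x.
    near=> n.
    have [H1 H2] : mean (P n) (Y n) (fun y => (`|y| <= x)%R%:R)
        <= mean Q Z (fun y => (`|y| < x')%R%:R) + e /\
      mean Q Z (fun y => (`|y| <= x)%R%:R) - e
        <= mean (P n) (Y n) (fun y => (`|y| < x')%R%:R).
      by near: n; exact: norm_law_squeeze.
    have x'0 := lt_trans x0 xx'.
    have := norm_lt_le lZ x'; have := norm_lt_le (lY n) x'.
    have := cdf_norm_le lZ sZ (ltW x0); have := cdf_norm_le lZ sZ (ltW x'0).
    have := cdf_norm_le (lY n) (sY n) (ltW x0).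
    have := cdf_norm_le (lY n) (sY n) (ltW x'0).
    by move: H1 H2; lra.
  have x'0 : x' < 0 by nra.
  have nx'0 : 0 < - x' by rewrite oppr_gt0.
  have nx0 : 0 < - x by rewrite oppr_gt0 (lt_trans xx').
  have nxx' : - x' < - x by rewrite ltrN2.
  near=> n.
  have [H1 H2] : mean (P n) (Y n) (fun y => (`|y| <= - x')%R%:R)
      <= mean Q Z (fun y => (`|y| < - x)%R%:R) + e /\
    mean Q Z (fun y => (`|y| <= - x')%R%:R) - e
      <= mean (P n) (Y n) (fun y => (`|y| < - x)%R%:R).
    by near: n; exact: norm_law_squeeze.
  have := norm_lt_le lZ (- x'); have := norm_lt_le (lY n) (- x').
  have := cdf_norm_lt lZ sZ nx0; have := cdf_norm_lt lZ sZ nx'0.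
  have := cdf_norm_lt (lY n) (sY n) nx0.
  have := cdf_norm_lt (lY n) (sY n) nx'0.
  by rewrite !opprK; move: H1 H2; lra.
apply/cvg_cdfP => // x cx; apply/cvgrPdist_le => e e0.
have e20 : 0 < e / 2 by rewrite divr_gt0.
have [r r0 xr] := cx _ e20.
have [x1 [x2 [xx1 x12 x2r x120]]] : exists x1 x2, [/\ x <= x1, x1 < x2, x2 <= x + r & 0 < x1 * x2].
  have [x0|x0] := leP 0 x.
    by exists (x + r / 2), (x + r); split; try lra; apply: mulr_gt0; lra.
  have [xr2|xr2] := leP (- x) r.
    by exists (x / 2), (x / 4); split; try lra; nra.
  by exists x, (x + r); split; try lra; nra.
have [x3 [x4 [xx3 x34 x4r x340]]] : exists x3 x4, [/\ x3 <= x, x4 < x3, x - r <= x4 & 0 < x4 * x3].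
  have [x0|x0] := leP x 0.
    by exists (x - r / 2), (x - r); split; try lra; nra.
  have [xr2|xr2] := leP x r.
    by exists (x / 2), (x / 4); split; try lra; nra.
  by exists x, (x - r); split; try lra; nra.
near=> n.
have [H1 _] : F n x1 <= FZ x2 + e / 2 /\ FZ x1 - e / 2 <= F n x2.
  by near: n; exact: squeeze.
have [_ H2] : F n x4 <= FZ x3 + e / 2 /\ FZ x4 - e / 2 <= F n x3.
  by near: n; exact: squeeze.
have G1 := cdfr_le (lY n) xx1; have G2 := cdfr_le (lY n) xx3.
have : `|FZ x2 - FZ x| <= e / 2 by apply: xr; rewrite ger0_norm; lra.
have : `|FZ x4 - FZ x| <= e / 2 by apply: xr; rewrite ler0_norm; lra.
rewrite !ler_norml => /andP[? ?] /andP[? ?].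
by apply/andP; split; lra.
Unshelve. all: by end_near. Qed.

(** Lower semicontinuity of the fourth moment: it dominates a finite combination
    of tail probabilities, which converge, and the corresponding combination for
    the limit is within [e / 3 + e / 3] of its fourth moment for a fine mesh [h]
    and a large number [N] of layers. *)
Lemma fourth_moment_lsc e : 0 < e ->
  (forall x, F n x @[n --> \oo] --> FZ x) ->
  \forall n \near \oo, mean Q Z (fun y => y ^+ 4) - e
     <= mean (P n) (Y n) (fun y => y ^+ 4).
Proof.
move=> e0 cF.
pose m k := mean Q Z (fun y => `|y| ^+ k).
have m0 k : 0 <= m k by apply: mean_ge0 => y; rewrite exprn_ge0.
have e60 : 0 < e / 3 by rewrite divr_gt0.
pose h := e / 3 / (4 * (m 3%N + 1)).
have h0 : 0 < h by rewrite divr_gt0// mulr_gt0// ltr_wpDl.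
have hm : 4 * h * m 3%N <= e / 3.
  have : h * (4 * (m 3%N + 1)) = e / 3.
    by rewrite divfK// mulf_neq0// gt_eqF// ltr_wpDl.
  by have := h0; nra.
pose N := (Num.truncn ((m 6%N / (e / 3) + 1) / h)).+1.
have hN : m 6%N / (e / 3) + 1 <= N%:R * h.
  by rewrite -ler_pdivrMr// ltW// truncnS_gt.
have Nm : m 6%N / (N%:R * h) ^+ 2 <= e / 3.
  have m60 : 0 <= m 6%N / (e / 3) by rewrite divr_ge0// ltW.
  have Nh1 : 1 <= N%:R * h by lra.
  rewrite ler_pdivrMr ?exprn_gt0//; last lra.
  rewrite mulrC -ler_pdivrMr// expr2.
  apply: (@le_trans _ _ (N%:R * h)); first by lra.
  by rewrite ler_peMl//; lra.
pose D (i : 'I_N) : R := (i.+1%:R * h) ^+ 4 - (i%:R * h) ^+ 4.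
have x0 (i : 'I_N) : 0 <= i.+1%:R * h by rewrite mulr_ge0// ltW.
have tD (i : 'I_N) : tame (fun y : R => (i.+1%:R * h < `|y|)%R%:R) by exact: tame_ltr_norm.
have tDZ (i : 'I_N) : tame (fun y : R => D i * (i.+1%:R * h < `|y|)%R%:R) by exact: tameZ.
pose S (G : R -> R) := \sum_(i < N) D i * (2 - 2 * G (i.+1%:R * h)).
have layers d0 (T0 : measurableType d0) (P0 : probability T0 R) (W : {RV P0 >-> R}) :
    light_tailed P0 W -> symmetric_law P0 W ->
    mean P0 W (fun y => \sum_(i < N) D i * (i.+1%:R * h < `|y|)%R%:R) =
    S (fun x => mean P0 W (fun y => (y <= x)%R%:R)).
  move=> lW sW; rewrite mean_sum//; apply: eq_bigr => i _.
  by rewrite meanZ// tail_norm.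
have cS : S (fun x => F n x) @[n --> \oo] --> S (fun x => FZ x).
  apply: cvg_sumr => i; apply: cvgMr; apply: cvgB; first exact: cvg_cst.
  by apply: cvgMr; exact: cF.
have tX k : tame (fun y : R => `|y| ^+ k).
  by apply: tameX; apply: tame_norm; exact: tame_id.
have t4 : tame (fun y : R => y ^+ 4) by apply: tameX; exact: tame_id.
have fourth_norm (y : R) : y ^+ 4 = `|y| ^+ 4.
  by rewrite -normrX ger0_norm// exprn_even_ge0.
have SZ : mean Q Z (fun y => y ^+ 4) - 4 * h * m 3%N - m 6%N / (N%:R * h) ^+ 2
    <= S (fun x => FZ x).
  rewrite -(layers _ _ _ Z lZ sZ) [_ / _]mulrC /m.
  rewrite -(meanZ lZ _ (tX 3%N)) -(meanZ lZ _ (tX 6%N)).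
  have t43 := tameB t4 (tameZ (4 * h) (tX 3%N)).
  rewrite -(meanB lZ t4 (tameZ (4 * h) (tX 3%N))).
  rewrite -(meanB lZ t43 (tameZ _ (tX 6%N))).
  apply: mean_le => // [||y].
  - by apply: tameB => //; exact: tameZ.
  - exact: tame_sum.
  - have /andP[+ _] := @fourth_layers R h `|y| N isT h0 (normr_ge0 y).
    by rewrite (fourth_norm y) (mulrC _ (`|y| ^+ 6)).
have SY n : S (fun x => F n x) <= mean (P n) (Y n) (fun y => y ^+ 4).
  rewrite -(layers _ _ _ (Y n) (lY n) (sY n)).
  apply: mean_le => // [|y]; first exact: tame_sum.
  have /andP[_] := @fourth_layers R h `|y| N isT h0 (normr_ge0 y).
  by rewrite (fourth_norm y).
move/cvgrPdist_le : cS => /(_ _ e60) cS.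
near=> n.
have : `|S (fun x => FZ x) - S (fun x => F n x)| <= e / 3 by near: n.
rewrite ler_norml => /andP[_ ?].
by have := SY n; lra.
Unshelve. all: by end_near. Qed.

End symmetric_convergence.

(** * The standard normal law *)

Section normal_law.
Context (R : realType).
Local Notation mu := (@lebesgue_measure R).
Local Notation Z := (std_normal R).
Local Notation gauss := (normal_prob (0 : R) 1).

Lemma ge0_integral_normal_prob (m s : R) (f : R -> \bar R) : s != 0 ->
  measurable_fun setT f -> (forall x, 0 <= f x)%E ->
  (\int[normal_prob m s]_x f x = \int[mu]_x (f x * (normal_pdf m s x)%:E))%E.
Proof.
move=> s0 mf f0.
have dom : normal_prob m s `<< mu by exact: normal_prob_dominates.
have mpdf : measurable_fun setT (EFin \o normal_pdf m s).
  by apply/measurable_EFinP; exact: measurable_normal_pdf.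
have iRN := Radon_Nikodym_SigmaFinite.f_integrable dom.
rewrite -(Radon_Nikodym_SigmaFinite.change_of_variables dom)//.
apply: ae_eq_integral => //.
- by apply: emeasurable_funM => //; exact: measurable_int iRN.
- by apply: emeasurable_funM.
- apply: ae_eqe_mul2l; apply: integral_ae_eq => // E _ mE.
  by rewrite -Radon_Nikodym_SigmaFinite.f_integral.
Qed.

(** Completing the square, [e^(s x)] times the standard normal density is
    [e^(s^2 / 2)] times the normal density of mean [s]. *)
Lemma normal_exponential_moment (s : R) :
  (\int[gauss]_x (expR (s * x))%:E = (expR (s ^+ 2 / 2))%:E)%E.
Proof.
have mexp : measurable_fun setT (fun x : measurableTypeR R => (expR (s * x))%:E).
  by apply/measurable_EFinP; exact: (tame_expR s).1.
rewrite (ge0_integral_normal_prob _ _ mexp)//.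
rewrite -[RHS]mule1 -[X in (_ * X)%E](@integral_normal_pdf _ s 1).
have mpdf : measurable_fun setT (fun x : measurableTypeR R => (normal_pdf s 1 x)%:E).
  by apply/measurable_EFinP; exact: measurable_normal_pdf.
rewrite -(ge0_integralZl mu measurableT mpdf); last 2 first.
- by move=> x _; rewrite lee_fin normal_pdf_ge0.
- by rewrite lee_fin expR_ge0.
apply: eq_integral => x _; rewrite -!EFinM !normal_pdfE// /normal_fun; congr EFin.
rewrite mulrCA [RHS]mulrCA -!expRD; congr (_ * expR _).
by rewrite expr1n; field.
Qed.

Lemma light_tailed_std_normal : light_tailed gauss Z.
Proof.
move=> s; apply/integrableP; split.
  by apply/measurable_EFinP; exact: (tame_expR s).1.
rewrite (eq_integral (fun x : measurableTypeR R => (expR (s * x))%:E)); last first.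
  by move=> x _ /=; rewrite ger0_norm ?expR_ge0.
by rewrite normal_exponential_moment ltry.
Qed.

Lemma mean_std_normal_expR s : mean gauss Z (fun y => expR (s * y)) = expR (s ^+ 2 / 2).
Proof. by rewrite /mean /Rintegral normal_exponential_moment. Qed.

Lemma ge0_integral_lebesgueN (f : measurableTypeR R -> \bar R) :
  measurable_fun setT f -> (forall x, 0 <= f x)%E ->
  (\int[mu]_x f x = \int[mu]_x f (- x)%R)%E.
Proof.
move=> mf f0.
have mN : measurable_fun setT (-%R : measurableTypeR R -> measurableTypeR R).
  exact: (tame_opp (tame_id R)).1.
have := ge0_integral_pushforward mN mu measurableT mf (fun x _ => f0 x).
rewrite preimage_setT => <-; apply: eq_measure_integral => A mA _.
exact/esym/lebesgue_measureN.
Qed.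

Lemma std_normal_symmetric (x : R) :
  mean gauss Z (fun y => (y <= x)%R%:R) = mean gauss Z (fun y => (- y <= x)%R%:R).
Proof.
rewrite /mean /Rintegral; congr fine.
have mler : measurable_fun setT
    (fun y : measurableTypeR R => ((y <= x)%R%:R)%:E : \bar R).
  by apply/measurable_EFinP; exact: (tame_ler x).1.
have mlerN : measurable_fun setT
    (fun y : measurableTypeR R => ((- y <= x)%R%:R)%:E : \bar R).
  by apply/measurable_EFinP; exact: (tame_opp (tame_ler x)).1.
rewrite (ge0_integral_normal_prob _ _ mler)//.
rewrite (ge0_integral_normal_prob _ _ mlerN)//.
have mpdf : measurable_fun setT (fun y : measurableTypeR R => (normal_pdf 0 1 y)%:E).
  by apply/measurable_EFinP; exact: measurable_normal_pdf.
rewrite ge0_integral_lebesgueN.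
- apply: eq_integral => y _; congr (_ * _%:E)%E.
  by rewrite !normal_pdfE// /normal_fun !subr0 sqrrN.
- by apply: emeasurable_funM.
- by move=> y; rewrite mule_ge0// lee_fin// normal_pdf_ge0.
Qed.

(** The density is bounded by its peak. *)
Lemma std_normal_lipschitz (a b : R) : a <= b ->
  mean gauss Z (fun y => (y <= b)%R%:R) - mean gauss Z (fun y => (y <= a)%R%:R)
   <= normal_peak 1 * (b - a).
Proof.
move=> ab; rewrite -meanB; [|exact: light_tailed_std_normal|exact: tame_ler|exact: tame_ler].
have mler c : measurable_fun setT (fun y : measurableTypeR R => (y <= c)%R%:R : R).
  exact: (tame_ler c).1.
have mf : measurable_fun setT
    (fun y : measurableTypeR R => ((y <= b)%R%:R - (y <= a)%R%:R)%:E : \bar R).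
  by apply/measurable_EFinP; exact: measurable_funB.
have f0 (y : R) : 0 <= (y <= b)%R%:R - (y <= a)%R%:R :> R.
  by rewrite subr_ge0 ler_nat; case: leP => //= ya; rewrite (le_trans ya).
have tb : tame (fun y : R => (y <= b)%R%:R - (y <= a)%R%:R).
  by apply: tameB; exact: tame_ler.
have ib := tame_integrable light_tailed_std_normal tb.
rewrite -lee_fin /mean /Rintegral fineK ?(integrable_fin_num _ ib)//.
rewrite (ge0_integral_normal_prob _ _ mf)//.
apply: (@le_trans _ _ (\int[mu]_y ((normal_peak 1)%:E * (\1_(`]a, b]%classic) y)%:E))%E).
  apply: ge0_le_integral => //=.
  - by move=> y _; rewrite mule_ge0 ?lee_fin ?normal_pdf_ge0.
  - by apply: emeasurable_funM => //; apply/measurable_EFinP; exact: measurable_normal_pdf.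
  - by apply: emeasurable_funM => //; apply/measurable_EFinP.
  - move=> y _; rewrite muleC; apply: lee_pmul.
    + by rewrite lee_fin normal_pdf_ge0.
    + by rewrite lee_fin.
    + by rewrite lee_fin normal_pdf_ub.
    + rewrite lee_fin indicE mem_setE in_itv/= ltNge.
      by case: (leP y a) => [ya|]; [rewrite (le_trans ya ab) subrr|rewrite subr0].
rewrite ge0_integralZl//= ?lee_fin ?normal_peak_ge0//; last exact/measurable_EFinP.
rewrite integral_indic//= setIT lebesgue_measure_itv/=.
by case: ifPn => _; rewrite ?EFinM// mule0 lee_fin mulr_ge0 ?normal_peak_ge0// subr_ge0.
Qed.

(** Compare the coefficients of [s^4] in [E e^(s Z) = e^(s^2 / 2)]. Uniqueness of
    Taylor coefficients is the constant case of [coef_cvg]. *)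
Lemma std_normal_moment4 : mean gauss Z (fun y => y ^+ 4) = 3.
Proof.
have lZ := light_tailed_std_normal.
(* Taylor coefficients of e^(s^2 / 2) at 0. *)
pose a (_ k : nat) : R := [:: 1; 0; 2^-1; 0; 8^-1]`_k.
pose b k : R := mean gauss Z (fun y => y ^+ k) / k`!%:R.
pose h s := expR (s ^+ 2 / 2) : R.
pose E1 := mean gauss Z (fun y => expR (1 * `|y|)).
have E10 : 0 <= E1 by apply: mean_ge0 => y; exact: expR_ge0.
pose C := expR 2^-1 + E1.
have ha K s : (K <= 5)%N -> 0 < s <= 1 ->
    `|h s - \sum_(k < K) a 0%N k * s ^+ k| <= C * s ^+ K.
  move=> K5 /andP[s0 s1].
  have s20 : 0 < s ^+ 2 by rewrite exprn_gt0.
  have s21 : s ^+ 2 <= 1 by rewrite exprn_ile1// ltW.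
  have := expR_tail (s ^+ 2 / 2) (uphalf K) s20 s21.
  have -> : `|s ^+ 2 / 2| / s ^+ 2 = 2^-1.
    by rewrite ger0_norm ?divr_ge0 ?sqr_ge0// mulrAC divff ?gt_eqF// mul1r.
  have -> : \sum_(k < K) a 0%N k * s ^+ k =
      \sum_(k < uphalf K) (s ^+ 2 / 2) ^+ k / k`!%:R.
    move: K5; case: K => [_|K]; first by rewrite !big_ord0.
    case: K => [|[|[|[|[|//]]]]] _;
      rewrite /= !big_ord_recr !big_ord0 /a /= ?factS ?fact0; by field.
  move=> /le_trans; apply; rewrite mulrC ler_pM ?expR_ge0 ?exprn_ge0 ?sqr_ge0 ?(ltW s0)//.
    by rewrite lerDl.
  rewrite -exprM ler_wiXn2l ?(ltW s0)//.
  rewrite mul2n uphalf_half doubleD -[leqLHS]odd_double_half leq_add2r.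
  by case: odd.
have hb K s : (K <= 5)%N -> 0 < s <= 1 ->
    `|h s - \sum_(k < K) b k * s ^+ k| <= C * s ^+ K.
  move=> _ s01; rewrite /h -mean_std_normal_expR.
  apply: (le_trans (mgf_taylor lZ K s01)).
  rewrite ler_wpM2r ?exprn_ge0//; first by case/andP : s01 => /ltW.
  by rewrite lerDr expR_ge0.
have : a n 4%N @[n --> \oo] --> b 4%N.
  apply: (@coef_cvg _ 5 a b (fun=> h) h C) => //.
  - by move=> s _; exact: cvg_cst.
  - by near=> n.
move=> /(cvg_unique (@Rhausdorff R) (cvg_cst _))/(congr1 (fun x => x * 4`!%:R)).
by rewrite /b /a divfK ?pnatr_eq0// => <- /=; rewrite !factS fact0; field.
Unshelve. all: by end_near. Qed.

End normal_law.

(** * Polynomials whose roots lie on the unit circle *)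

Section unit_circle_polynomials.
Context (R : realType).
Implicit Types (p : {poly R}) (v : seq R).

(** For [|z| = 1], [(X - z)(X - conj z) = X^2 - 2 Re z X + 1], which is
    [(X - 1)^2 + 2 (1 - Re z) X]. Pairing every root with its conjugate inside the
    square [p^2] treats all roots alike, including [-1] when its multiplicity is
    odd. The root 1 is excluded by [p(1) = 1]; the constant factor is
    found by evaluation at 1. *)
Lemma unit_roots_square p n : size p = n.+1 -> p.[1] = 1 -> unit_roots p ->
  exists v, [/\ size v = n, forall x, x \in v -> 4^-1 <= x &
    p ^+ 2 = \prod_(x <- v) ('X + x *: ('X - 1) ^+ 2)].
Proof.
move=> szp p1 up.
pose toC := real_complex R.
pose q := map_poly toC p.
have [r qE] := closed_field_poly_normal q.
have szq : size q = n.+1 by rewrite size_map_poly.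
have q0 : q != 0 by rewrite -size_poly_eq0 szq.
have lq0 : lead_coef q != 0 by rewrite lead_coef_eq0.
have szr : size r = n.
  by move: szq; rewrite qE size_scale// size_prod_XsubC => -[].
have rootr z : z \in r -> root q z.
  by move=> zr; rewrite qE rootZ// root_prod_XsubC.
have q1 : q.[1] = 1.
  by rewrite -(rmorph1 toC) horner_map/= p1.
have zn1 z : z \in r -> z != 1.
  move=> zr; apply/eqP => z1; have := rootr z zr.
  by rewrite z1 /root q1 oner_eq0.
have unit_z z : z \in r -> complex.Re z ^+ 2 + complex.Im z ^+ 2 = 1.
  move=> zr; have /up zE := rootr z zr.
  by apply: (@complexI R); rewrite add_Re2_Im2 zE expr1n.
have Re_lt1 z : z \in r -> 0 < 1 - complex.Re z.
  move=> zr; have u := unit_z z zr.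
  have i0 : 0 <= complex.Im z ^+ 2 by exact: sqr_ge0.
  rewrite lt_neqAle; apply/andP; split; last by rewrite subr_ge0; nra.
  apply/eqP => /esym/eqP; rewrite subr_eq0 => /eqP re1.
  have : complex.Im z ^+ 2 = 0 by move: u; rewrite -re1 expr1n; lra.
  move/eqP; rewrite sqrf_eq0 => /eqP im0.
  by have := zn1 z zr; rewrite eq_complex/= -re1 im0 !eqxx.
pose w z : R := (2 * (1 - complex.Re z))^-1.
exists (map w r); split.
- by rewrite size_map.
- move=> x /mapP[z zr ->]; rewrite /w lef_pV2 ?posrE ?mulr_gt0 ?Re_lt1//.
  have u := unit_z z zr; have : 0 <= complex.Im z ^+ 2 by exact: sqr_ge0.
  by have := Re_lt1 z zr; nra.
have qconj : q = lead_coef q *: \prod_(z <- r) ('X - (z^*%C)%:P).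
  have : map_poly (@conjc R) q = q.
    by rewrite -map_poly_comp; apply: eq_map_poly => x /=; rewrite oppr0.
  move=> <-; rewrite {1}qE map_polyZ rmorph_prod; congr (_ *: _).
    by rewrite [RHS]lead_coef_map.
  by apply: eq_bigr => z _; exact: map_polyXsubC.
have factor z : z \in r -> ('X - z%:P) * ('X - (z^*%C)%:P) =
    toC (2 * (1 - complex.Re z)) *: map_poly toC ('X + w z *: ('X - 1) ^+ 2).
  move=> zr; set c := 2 * (1 - complex.Re z).
  have cn0 : c != 0 by rewrite gt_eqF// mulr_gt0// Re_lt1.
  rewrite rmorphD/= map_polyX map_polyZ rmorphXn rmorphB/= map_polyX rmorph1.
  rewrite scalerDr scalerA -rmorphM/= divff// rmorph1 scale1r.
  have zD : z + z^*%C = 2 - toC c.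
    by rewrite addcJ /c /toC rmorphM rmorphB rmorph1 rmorph_nat; ring.
  have zM : z * z^*%C = 1.
    rewrite -sqr_normc (_ : `|z| = 1) ?expr1n//.
    exact: (up _ (rootr z zr)).
  rewrite -mul_polyC.
  transitivity ('X ^+ 2 - (z + z^*%C)%:P * 'X + (z * z^*%C)%:P).
    by rewrite polyCD polyCM; ring.
  by rewrite zD zM polyCB polyCMn polyC1; ring.
pose f := \prod_(x <- map w r) ('X + x *: ('X - 1) ^+ 2).
have [K qK] : exists K, q ^+ 2 = K *: map_poly toC f.
  exists (lead_coef q ^+ 2 * \prod_(z <- r) toC (2 * (1 - complex.Re z))).
  rewrite expr2 {1}qE [X in _ * X]qconj -scalerAl -scalerAr scalerA -expr2 -scalerA.
  congr (_ *: _); rewrite -big_split/= /f big_map rmorph_prod -scaler_prod.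
  by rewrite !big_seq; apply: eq_bigr => z zr; rewrite factor.
have f1 : f.[1] = 1.
  rewrite /f horner_prod big1// => x _.
  rewrite hornerD hornerX hornerZ horner_exp (_ : ('X - 1).[1] = 0).
    by rewrite expr0n mulr0 addr0.
  by rewrite -polyC1 hornerXsubC subrr.
have K1 : K = 1.
  have := congr1 (horner^~ 1) qK; rewrite /= horner_exp q1 expr1n hornerZ.
  by rewrite -{2}(rmorph1 toC) horner_map/= f1 mulr1.
apply: (@map_poly_inj _ _ toC).
by rewrite rmorphXn/= -/q qK K1 scale1r.
Qed.

(** The reciprocal polynomial [x^n p(1 / x)] has the same square as [p], as each
    factor [x + v (x - 1)^2] is reciprocal of degree 2, and both are positive for
    [x > 0]. *)
Lemma palindromic p v n : (forall k, 0 <= p`_k) -> size p = n.+1 ->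
  (forall x, x \in v -> 0 <= x) -> size v = n ->
  p ^+ 2 = \prod_(x <- v) ('X + x *: ('X - 1) ^+ 2) ->
  forall k, (k <= n)%N -> p`_k = p`_(n - k).
Proof.
move=> p0 szp v0 szv p2.
pose p' := \poly_(k < n.+1) p`_(n - k).
have p'E x : 0 < x -> p'.[x] = x ^+ n * p.[x^-1].
  move=> x0; rewrite horner_poly horner_coef szp mulr_sumr.
  rewrite (reindex_inj rev_ord_inj)/=; apply: eq_bigr => k _.
  rewrite subSS subKn ?leq_ord// mulrCA; congr (_ * _).
  by rewrite exprVn -expfB_cond// (gt_eqF x0) add0n -ltnS.
have ppos x : 0 < x -> 0 < p.[x].
  move=> x0; rewrite horner_coef szp big_ord_recr/= ltr_wpDl//.
    by apply: sumr_ge0 => k _; rewrite mulr_ge0// exprn_ge0// ltW.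
  rewrite mulr_gt0 ?exprn_gt0// lt_neqAle p0 andbT eq_sym.
  by have := lead_coef_eq0 p; rewrite lead_coefE szp/= => ->; rewrite -size_poly_eq0 szp.
have sq x : p.[x] ^+ 2 = \prod_(y <- v) (x + y * (x - 1) ^+ 2).
  rewrite -horner_exp p2 horner_prod; apply: eq_bigr => y _.
  by rewrite !hornerE.
have eqp x : 0 < x -> p'.[x] = p.[x].
  move=> x0; apply/eqP; rewrite -(@eqrXn2 _ 2)//.
  - rewrite p'E// exprMn sq.
    have -> : (x ^+ n) ^+ 2 = \prod_(y <- v) x ^+ 2.
      by rewrite big_const_seq count_predT iter_mulr_1 szv exprAC.
    rewrite -big_split/= sq; apply/eqP; apply: eq_bigr => y _.
    by field; rewrite gt_eqF.
  - by rewrite p'E// mulr_ge0 ?exprn_ge0 ?ltW// ppos ?invr_gt0.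
  - by rewrite ltW// ppos.
(* Two polynomials that agree at 1, 2, 3, ... are equal. *)
suff pp : p' = p by move=> k kn; rewrite -{1}pp coef_poly ltnS kn.
apply/eqP; rewrite -subr_eq0; apply/negPn/negP => pn0.
have := max_poly_roots pn0 (rs := [seq i.+1%:R | i <- iota 0 (size (p' - p))]).
rewrite size_map size_iota ltnn => H; suff : false by []; apply: H.
  apply/allP => _ /mapP[i _ ->]; rewrite /root hornerD hornerN eqp ?subrr//.
by rewrite map_inj_uniq ?iota_uniq// => i j /eqP; rewrite eqr_nat => /eqP[].
Qed.

(** The product that becomes of [P^2] in the variable [z - 1], modulo its fifth
    power. *)
Lemma prod_quadratic_coef (v : seq R) :
  let q := \prod_(x <- v) (1 + 'X + x *: 'X ^+ 2) in
  let n := (size v)%:R in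
  let e1 := \sum_(x <- v) x in let s2 := \sum_(x <- v) x ^+ 2 in
  [/\ q`_0 = 1, q`_1 = n, q`_2 = n * (n - 1) / 2 + e1,
      q`_3 = n * (n - 1) * (n - 2) / 6 + (n - 1) * e1 &
      q`_4 = n * (n - 1) * (n - 2) * (n - 3) / 24
             + (n - 1) * (n - 2) / 2 * e1 + (e1 ^+ 2 - s2) / 2].
Proof.
elim: v => [|x v IH] /=.
  rewrite !big_nil !coef1 /=; split=> //; by field.
move: IH; rewrite !big_cons /=; set q := \prod_(y <- v) _.
set e1 := \sum_(y <- v) y; set s2 := \sum_(y <- v) y ^+ 2.
move=> [q0 q1 q2 q3 q4].
have E k : ((1 + 'X + x *: 'X ^+ 2) * q)`_k.+2 = q`_k.+2 + q`_k.+1 + x * q`_k.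
  rewrite !mulrDl mul1r -scalerAl !coefD coefZ.
  by rewrite -['X * q]mulrC coefMX -['X^2 * q]mulrC coefMXn /= subn2.
have E0 : ((1 + 'X + x *: 'X ^+ 2) * q)`_0 = q`_0.
  rewrite !mulrDl mul1r -scalerAl !coefD coefZ.
  by rewrite -['X * q]mulrC coefMX -['X^2 * q]mulrC coefMXn /= mulr0 !addr0.
have E1 : ((1 + 'X + x *: 'X ^+ 2) * q)`_1 = q`_1 + q`_0.
  rewrite !mulrDl mul1r -scalerAl !coefD coefZ.
  by rewrite -['X * q]mulrC coefMX -['X^2 * q]mulrC coefMXn /= mulr0 !addr0.
rewrite !E E0 E1 q0 q1 q2 q3 q4 -!natr1.
split=> //; by field.
Qed.

End unit_circle_polynomials.

(** * The law of a variable whose generating polynomial has unit roots *)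

Section lattice_variable.
Context d (T : measurableType d) (R : realType) (P : probability T R).

Lemma bounded_light_tailed (Y : {RV P >-> R}) (M : R) :
  (forall t, `|Y t| <= M) -> light_tailed P Y.
Proof.
move=> YM s.
have tY := tame_expR s.
apply: measurable_bounded_integrable => //.
- by rewrite (le_lt_trans (probability_le1 P measurableT))// ltry.
- exact: (measurableT_comp tY.1).
- exists (expR (`|s| * M)); split; first exact: num_real.
  move=> x Mx t _ /=; rewrite ger0_norm ?expR_ge0// (le_trans _ (ltW Mx))//.
  rewrite ler_expR (le_trans (ler_norm _))// normrM ler_wpM2l//.
Qed.

Context (n : nat) (X : {RV P >-> R}).
Hypothesis X_range : forall t, exists2 k : nat, (k <= n)%N & X t = k%:R.

Let X_light : light_tailed P X.
Proof.
apply: (@bounded_light_tailed _ n%:R) => t; have [k kn ->] := X_range t.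
by rewrite ger0_norm// ler_nat.
Qed.

Lemma mean_lattice (g : R -> R) :
  mean P X g = \sum_(k < n.+1) pmf X k%:R * g k%:R.
Proof.
have tb (x : R) : tame (fun y => (y == x)%:R).
  by apply: tame_bool; exact: measurable_fun_eqr.
pose h (y : R) := \sum_(k < n.+1) g k%:R * (y == k%:R)%:R.
have -> : mean P X g = mean P X h.
  apply: eq_Rintegral => t _; have [k kn ->] := X_range t.
  rewrite /h (bigD1 (Ordinal (kn : (k < n.+1)%N)))//= eqxx mulr1 big1 ?addr0// => i ik.
  by rewrite eqr_nat -[k]/(val (Ordinal (kn : (k < n.+1)%N))) val_eqE eq_sym (negbTE ik) mulr0.
rewrite mean_sum//; last by move=> k; exact: tameZ.
apply: eq_bigr => k _; rewrite meanZ// mulrC; congr (_ * _).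
rewrite /mean /Rintegral /pmf; congr fine.
transitivity (\int[P]_t (\1_(X @^-1` [set k%:R]) t)%:E)%E.
  apply: eq_integral => t _; rewrite indicE.
  by case: eqP => XE; [rewrite mem_set|rewrite memNset].
by rewrite integral_indic// ?setIT.
Qed.

Lemma mean_standardize (g : R -> R) :
  mean P (standardize X) g =
  mean P X (fun x => g ((x - fine 'E_P[X]) / Num.sqrt (fine 'V_P[X]))).
Proof. by []. Qed.

Lemma fine_expectationE : fine 'E_P[X] = mean P X id.
Proof. by rewrite unlock. Qed.

Lemma fine_varianceE : fine 'V_P[X] = mean P X (fun x => (x - fine 'E_P[X]) ^+ 2).
Proof.
rewrite /variance covariance.unlock /mean /Rintegral expectation.unlock.
by congr fine; apply: eq_integral => t _; rewrite /= expr2.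
Qed.

End lattice_variable.

Section binomial_moments.
Context (R : realType).

Lemma bin_natr (k : nat) :
  [/\ 'C(k, 1)%:R = k%:R :> R, 'C(k, 2)%:R = k%:R * (k%:R - 1) / 2 :> R,
      'C(k, 3)%:R = k%:R * (k%:R - 1) * (k%:R - 2) / 6 :> R &
      'C(k, 4)%:R = k%:R * (k%:R - 1) * (k%:R - 2) * (k%:R - 3) / 24 :> R].
Proof.
elim: k => [|k [b1 b2 b3 b4]]; first by rewrite !bin0n !mul0r.
by rewrite !binS !natrD bin0 b1 b2 b3 b4 -natr1; split; field.
Qed.

(** The Taylor coefficients at 1 of a generating polynomial are the binomial
    moments. *)
Lemma coef_comp_polyXD1 (p : {poly R}) m :
  (p \Po ('X + 1))`_m = \sum_(k < size p) p`_k * 'C(k, m)%:R.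
Proof.
rewrite comp_polyE coef_sum; apply: eq_bigr => k _.
rewrite coefZ exprD1n coef_sum; congr (_ * _).
have [mk|km] := leqP m k.
  rewrite (bigD1 (Ordinal (mk : (m < k.+1)%N)))//= coefMn coefXn eqxx big1 ?addr0// => i im.
  rewrite coefMn coefXn -[m]/(val (Ordinal (mk : (m < k.+1)%N))) val_eqE eq_sym.
  by rewrite (negbTE im) mul0rn.
rewrite bin_small// big1// => i _; rewrite coefMn coefXn.
by rewrite gtn_eqF ?mul0rn// (leq_trans (ltn_ord i)).
Qed.

(** The binomial moments [b m] are determined by the Taylor coefficients at 1 of
    [p^2], since those are the convolution square of the [b m] and [b 0 = 1]; the
    central moments are combinations of binomial moments. *)
Lemma unit_roots_moments (p : {poly R}) v n : size p = n.+1 -> p.[1] = 1 ->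
  size v = n ->
  p ^+ 2 = \prod_(x <- v) ('X + x *: ('X - 1) ^+ 2) ->
  let V := \sum_(x <- v) x in let s2 := \sum_(x <- v) x ^+ 2 in
  let E (g : R -> R) := \sum_(k < n.+1) p`_k * g k%:R in
  [/\ E id = n%:R / 2, E (fun x => (x - n%:R / 2) ^+ 2) = V &
      E (fun x => (x - n%:R / 2) ^+ 4) = 3 * V ^+ 2 + V - 6 * s2].
Proof.
move=> szp p1 szv p2 V s2 E.
pose q := p \Po ('X + 1).
pose b m := \sum_(k < n.+1) p`_k * 'C(k, m)%:R.
have qb m : q`_m = b m by rewrite coef_comp_polyXD1 szp.
have b0 : b 0%N = 1.
  rewrite -p1 horner_coef szp; apply: eq_bigr => k _.
  by rewrite bin0 expr1n.
have q2 : q ^+ 2 = \prod_(x <- v) (1 + 'X + x *: 'X ^+ 2).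
  rewrite expr2 -comp_polyM -expr2 p2.
  rewrite (big_morph (comp_poly ('X + 1)) (fun f g => comp_polyM f g ('X + 1)) (comp_polyC 1 _)).
  apply: eq_bigr => x _.
  rewrite comp_polyD comp_polyX comp_polyZ !expr2 comp_polyM comp_polyB comp_polyX.
  have -> : 1 \Po ('X + 1) = 1 :> {poly R} by rewrite -polyC1 comp_polyC.
  by rewrite addrK (addrC 'X).
have := prod_quadratic_coef v; rewrite /= szv -q2 -/V -/s2.
rewrite !expr2 !coefM !big_ord_recr !big_ord0 /= !qb b0.
move=> [_ c1 c2 c3 c4].
have b1 : b 1%N = n%:R / 2 by move: c1; lra.
have b2 : b 2%N = (n%:R * (n%:R - 1) / 2 + V - b 1%N ^+ 2) / 2.
  by move: c2; rewrite expr2; lra.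
have b3 : b 3%N = (n%:R * (n%:R - 1) * (n%:R - 2) / 6 + (n%:R - 1) * V
    - 2 * b 1%N * b 2%N) / 2.
  by move: c3; lra.
have b4 : b 4%N = (n%:R * (n%:R - 1) * (n%:R - 2) * (n%:R - 3) / 24
     + (n%:R - 1) * (n%:R - 2) / 2 * V + (V ^+ 2 - s2) / 2
    - 2 * b 1%N * b 3%N - b 2%N ^+ 2) / 2.
  by move: c4; rewrite !expr2; lra.
have Eb (g : R -> R) (a0 a1 a2 a3 a4 : R) :
    (forall k : nat, g k%:R = a0 * 'C(k, 0)%:R + a1 * 'C(k, 1)%:R
      + a2 * 'C(k, 2)%:R + a3 * 'C(k, 3)%:R + a4 * 'C(k, 4)%:R) ->
    E g = a0 + a1 * b 1%N + a2 * b 2%N + a3 * b 3%N + a4 * b 4%N.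
  move=> gE; rewrite -[X in X + _ + _ + _ + _](mulr1 a0) -b0 /b !mulr_sumr -!big_split/=.
  by apply: eq_bigr => k _; rewrite gE; ring.
pose h := n%:R / 2 : R.
split.
- rewrite (@Eb _ 0 1 0 0 0); first by rewrite b1; ring.
  by move=> k; have [-> _ _ _] := bin_natr k; rewrite /=; ring.
- rewrite (@Eb _ (h ^+ 2) (1 - 2 * h) 2 0 0).
    by rewrite b2 b1 /h; field.
  by move=> k; have [-> -> _ _] := bin_natr k; rewrite bin0 /h; field.
- rewrite (@Eb _ (h ^+ 4) (1 - 4 * h + 6 * h ^+ 2 - 4 * h ^+ 3)
    (14 - 24 * h + 12 * h ^+ 2) (36 - 24 * h) 24).
    by rewrite b4 b3 b2 b1 /h; field.
  by move=> k; have [-> -> -> ->] := bin_natr k; rewrite bin0 /h; field.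
Qed.

End binomial_moments.

(** All that the proof needs to know of the law of a standardized variable whose
    generating polynomial has unit roots: [v] is the list of weights of the roots,
    and its sum is the variance before standardization. *)
Definition weighted_law d (T : measurableType d) (R : realType)
    (P : probability T R) (Y : T -> R) (v : seq R) : Prop :=
  let V := \sum_(x <- v) x in let s2 := \sum_(x <- v) x ^+ 2 in
  [/\ forall x, x \in v -> 4^-1 <= x, light_tailed P Y & symmetric_law P Y] /\
  [/\ mean P Y (fun y => y ^+ 2) = 1,
     mean P Y (fun y => y ^+ 4) = 3 + (V - 6 * s2) / V ^+ 2 &
     forall s, mean P Y (fun y => expR (s * y)) ^+ 2 =
       \prod_(x <- v) (1 + x * (expR (s / (2 * Num.sqrt V))
          - expR (- (s / (2 * Num.sqrt V)))) ^+ 2)].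

Section unitary_law.
Context d (T : measurableType d) (R : realType) (P : probability T R).
Context (n : nat) (X : {RV P >-> R}).
Hypothesis n_gt0 : (0 < n)%N.
Hypothesis X_range : forall t, exists2 k : nat, (k <= n)%N & X t = k%:R.
Hypothesis pgf_degree : size (prob_gen_poly n X) = n.+1.
Hypothesis pgf_roots : unit_roots (prob_gen_poly n X).
Local Notation Y := (standardize X).

(** The formula for the square of the moment generating function is [P(z)^2]
    evaluated at [z = e^(2 a)] with [a = s / (2 sqrt V)], each of the [n] factors
    [z + x (z - 1)^2] being divided by [z]. *)
Lemma unitary_law : exists2 v : seq R, size v = n & weighted_law P Y v.
Proof.
pose p := prob_gen_poly n X.
have szp : size p = n.+1 := pgf_degree.
have up : unit_roots p := pgf_roots.
have pk (k : 'I_n.+1) : p`_k = pmf X k%:R by rewrite coef_poly ltn_ord.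
have p0 k : 0 <= p`_k by rewrite coef_poly; case: ifP => // _; exact: pmf_ge0.
have EX (g : R -> R) : mean P X g = \sum_(k < n.+1) p`_k * g k%:R.
  by rewrite (mean_lattice X_range); apply: eq_bigr => k _; rewrite pk.
have p1 : p.[1] = 1.
  rewrite -[RHS](mean_cst X 1) EX horner_coef szp.
  by apply: eq_bigr => k _; rewrite expr1n.
have [v [szv v4 p2]] := unit_roots_square szp p1 up.
have v0 x : x \in v -> 0 <= x by move/v4; apply: le_trans; rewrite invr_ge0.
have := unit_roots_moments szp p1 szv p2.
set V := \sum_(x <- v) x; set s2 := \sum_(x <- v) x ^+ 2 => -[m1 m2 m4].
have mu : fine 'E_P[X] = n%:R / 2 by rewrite fine_expectationE EX.
have var : fine 'V_P[X] = V by rewrite fine_varianceE mu EX.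
have V0 : 0 < V.
  rewrite /V; move: szv v4; case: (v) => [/esym n0|x w _ w4].
    by move: n_gt0; rewrite n0.
  rewrite big_cons ltr_pwDl//.
    by rewrite (lt_le_trans _ (w4 x (mem_head _ _)))// invr_gt0.
  rewrite big_seq sumr_ge0// => y yw.
  by rewrite (le_trans _ (w4 y _)) ?invr_ge0// inE yw orbT.
pose sg := Num.sqrt V.
have sg0 : 0 < sg by rewrite sqrtr_gt0.
have sg2 : sg ^+ 2 = V by rewrite sqr_sqrtr// ltW.
have EY (g : R -> R) : mean P Y g = \sum_(k < n.+1) p`_k * g ((k%:R - n%:R / 2) / sg).
  by rewrite mean_standardize EX mu var.
exists v => //; rewrite /weighted_law /=; split; split=> //.
- apply: (@bounded_light_tailed _ _ _ _ _ (n%:R / sg)) => t /=.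
  have [k kn Xk] := X_range t.
  rewrite /standardize mu var Xk normrM normfV (gtr0_norm sg0) ler_pM2r ?invr_gt0//.
  have k0 : 0 <= k%:R :> R by [].
  have kn' : k%:R <= n%:R :> R by rewrite ler_nat.
  by rewrite ler_norml; apply/andP; split; lra.
- move=> x; rewrite !EY (reindex_inj rev_ord_inj)/=; apply: eq_bigr => k _.
  rewrite subSS (palindromic p0 szp v0 szv p2 (leq_subr _ _)) subKn ?leq_ord//.
  congr (_ * (_ <= x)%R%:R); rewrite natrB ?leq_ord//.
  by field; rewrite gt_eqF.
- rewrite EY; transitivity (V / V); last by rewrite divff ?gt_eqF.
  rewrite -[X in _ = X / _]m2 mulr_suml; apply: eq_bigr => k _.
  by rewrite exprMn exprVn sg2 mulrA.
- rewrite EY (_ : 3 + _ = (3 * V ^+ 2 + V - 6 * s2) / V ^+ 2); last first.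
    by rewrite -/V -/s2; field; rewrite gt_eqF.
  rewrite -m4 mulr_suml; apply: eq_bigr => k _.
  by rewrite exprMn exprVn -{1}sg2 -exprM mulrA.
- move=> s; rewrite -/V -/sg; set a := s / (2 * sg).
  have -> : mean P Y (fun y => expR (s * y)) = expR (- (n%:R * a)) * p.[expR (2 * a)].
    rewrite EY horner_coef szp mulr_sumr; apply: eq_bigr => k _.
    rewrite [RHS]mulrCA -expRM_natl -expRD; congr (_ * expR _).
    by rewrite /a; field; rewrite gt_eqF.
  have pE : p.[expR (2 * a)] ^+ 2 =
      \prod_(x <- v) (expR (2 * a) + x * (expR (2 * a) - 1) ^+ 2).
    rewrite -horner_exp p2 horner_prod; apply: eq_bigr => y _.
    by rewrite !hornerE.
  rewrite exprMn pE.
  have -> : expR (- (n%:R * a)) ^+ 2 = \prod_(x <- v) expR (- (2 * a)).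
    rewrite big_const_seq count_predT iter_mulr_1 szv -!expRM_natl; congr expR.
    by ring.
  rewrite -big_split/=; apply: eq_bigr => x _.
  have eE : expR (2 * a) = expR a ^+ 2 by rewrite -expRM_natl.
  rewrite [expR (- a)]expRN [expR (- (2 * a))]expRN eE.
  by field; rewrite gt_eqF// expR_gt0.
Qed.

End unitary_law.

(** * Asymptotics of the moment generating function *)

Section mgf_asymptotics.
Context (R : realType) (v : nat -> seq R).
Hypothesis size_v : forall n, size (v n) = n.+1.
Hypothesis v_ge : forall n x, x \in v n -> 4^-1 <= x.
Let V n := \sum_(x <- v n) x.
Let s2 n := \sum_(x <- v n) x ^+ 2.
Let w n (s : R) := expR (s / (2 * Num.sqrt (V n))) - expR (- (s / (2 * Num.sqrt (V n)))).

Lemma variance_lower_bound n : n.+1%:R / 4 <= V n.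
Proof.
rewrite /V; have -> : n.+1%:R / 4 = \sum_(x <- v n) 4^-1 :> R.
  by rewrite big_const_seq count_predT iter_addr_0 size_v mulr_natl.
by rewrite big_seq [leRHS]big_seq; apply: ler_sum => x; exact: v_ge.
Qed.

Lemma variance_gt0 n : 0 < V n.
Proof. by apply: lt_le_trans (variance_lower_bound n); rewrite divr_gt0. Qed.

Lemma variance_le_squares n : V n <= 4 * s2 n.
Proof.
rewrite /V /s2 mulr_sumr big_seq [leRHS]big_seq; apply: ler_sum => x /v_ge.
by rewrite expr2; nra.
Qed.

Lemma deviation_infty (A : R) : \forall n \near \oo, A <= Num.sqrt (V n).
Proof.
near=> n; apply: (le_trans (ler_norm A)); rewrite -sqrtr_sqr ler_wsqrtr//.
apply: le_trans (variance_lower_bound n); rewrite ler_pdivlMr//.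
apply: (@le_trans _ _ n%:R); last by rewrite ler_nat.
by near: n; exact: nbhs_infty_ger.
Unshelve. all: by end_near. Qed.

Lemma cvg_sinh s : Num.sqrt (V n) * w n s @[n --> \oo] --> s.
Proof.
apply/cvgrPdist_le => e e0; near=> n.
have s1 : 1 <= Num.sqrt (V n) by near: n; exact: deviation_infty.
have s3 : `|s| <= Num.sqrt (V n) by near: n; exact: deviation_infty.
have s4 : expR 1 * s ^+ 2 / e <= Num.sqrt (V n) by near: n; exact: deviation_infty.
rewrite distrC; set sg := Num.sqrt (V n) in s1 s3 s4 *.
apply: (le_trans (@sinh_rescaled _ sg s _ _)); try lra.
rewrite ler_pdivrMr; last lra.
move: s4; rewrite ler_pdivrMr// => s4; apply: (le_trans s4).
by rewrite mulrC ler_pM2l//; lra.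
Unshelve. all: by end_near. Qed.

Let L n s := V n * w n s ^+ 2.

Lemma cvg_exponent s : L n s @[n --> \oo] --> s ^+ 2.
Proof.
have -> : (fun n => L n s) = (fun n => (Num.sqrt (V n) * w n s) * (Num.sqrt (V n) * w n s)).
  apply/funext => n; rewrite -expr2 exprMn sqr_sqrtr//.
  exact: ltW (variance_gt0 n).
by rewrite expr2; apply: cvgM; exact: cvg_sinh.
Qed.

Lemma mgf_square_le n s :
  \prod_(x <- v n) (1 + x * w n s ^+ 2) <= expR (L n s).
Proof.
have -> : L n s = \sum_(x <- v n) x * w n s ^+ 2 by rewrite /L mulr_suml.
apply: prod_1D_le_expR => x /v_ge x4; rewrite mulr_ge0 ?sqr_ge0//.
by rewrite (le_trans _ x4)// invr_ge0.
Qed.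

(** The quotient of the sum of the squares of the weights by the square of their
    sum is the only obstruction to a Gaussian limit. *)
Lemma mgf_square_ge n s :
  expR (L n s - L n s ^+ 2 * (s2 n / V n ^+ 2))
    <= \prod_(x <- v n) (1 + x * w n s ^+ 2).
Proof.
have -> : L n s ^+ 2 * (s2 n / V n ^+ 2) = \sum_(x <- v n) (x * w n s ^+ 2) ^+ 2.
  under eq_bigr do rewrite exprMn.
  rewrite -mulr_suml -/(s2 n) /L; field.
  by rewrite gt_eqF// variance_gt0.
have -> : L n s = \sum_(x <- v n) x * w n s ^+ 2 by rewrite /L mulr_suml.
apply: expR_le_prod_1D => x /v_ge x4; rewrite mulr_ge0 ?sqr_ge0//.
by rewrite (le_trans _ x4)// invr_ge0.
Qed.

Context (M : nat -> R -> R).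
Hypothesis M_ge0 : forall n s, 0 <= M n s.
Hypothesis M_square : forall n s, M n s ^+ 2 = \prod_(x <- v n) (1 + x * w n s ^+ 2).

(** Exponential moments stay bounded even when the limit is not normal, which
    gives uniform integrability in the Bernoulli case. *)
Lemma mgf_bounded s : \forall n \near \oo, M n s <= expR ((s ^+ 2 + 1) / 2).
Proof.
near=> n.
have Ln : L n s <= s ^+ 2 + 1.
  by near: n; apply: (cvgr_le _ (@cvg_exponent s)); rewrite ltrDl.
rewrite -(@ler_pXn2r _ 2)// ?nnegrE ?expR_ge0//.
rewrite M_square (le_trans (mgf_square_le n s))// -expRM_natl ler_expR.
by rewrite mulrC divfK.
Unshelve. all: by end_near. Qed.

Lemma mgf_gaussian s : s2 n / V n ^+ 2 @[n --> \oo] --> 0 ->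
  M n s @[n --> \oo] --> expR (s ^+ 2 / 2).
Proof.
move=> r0.
have cL := @cvg_exponent s.
have M2 : M n s ^+ 2 @[n --> \oo] --> expR (s ^+ 2).
  apply: (@squeeze_cvgr _ _ _ _ (fun n => expR (L n s - L n s ^+ 2 * (s2 n / V n ^+ 2)))
      (fun n => expR (L n s))).
  - by near=> n; rewrite M_square mgf_square_le mgf_square_ge.
  - apply: continuous_cvg; first exact: continuous_expR.
    rewrite -[X in _ --> X]subr0 -(mulr0 ((s ^+ 2) ^+ 2)).
    apply: cvgB => //; apply: cvgM => //.
    by under eq_fun do rewrite expr2; rewrite expr2; exact: cvgM.
  - by apply: continuous_cvg => //; exact: continuous_expR.
have -> : expR (s ^+ 2 / 2) = Num.sqrt (expR (s ^+ 2)).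
  have -> : s ^+ 2 = 2%:R * (s ^+ 2 / 2) by rewrite mulrC divfK.
  by rewrite expRM_natl sqrtr_sqr ger0_norm ?expR_ge0// mulrAC divff// mul1r.
have -> : (fun n => M n s) = (fun n => Num.sqrt (M n s ^+ 2)).
  by apply/funext => n; rewrite sqrtr_sqr ger0_norm.
by apply: continuous_cvg => //; exact: sqrt_continuous.
Unshelve. all: by end_near. Qed.

End mgf_asymptotics.

(** * The symmetric Bernoulli law *)

Section sign_law.
Context (R : realType).
Local Notation B := (sym_bernoulli R).
Local Notation Q := (bernoulli_prob (2^-1 : R)).

Lemma light_tailed_sym_bernoulli : light_tailed Q B.
Proof.
apply: (@bounded_light_tailed _ _ _ _ _ 1) => -[] /=.
  by rewrite /sym_bernoulli /= /sign_fun normr1.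
by rewrite /sym_bernoulli /= /sign_fun normrN1.
Qed.

Lemma cdf_sym_bernoulli (x : R) :
  mean Q B (fun y => (y <= x)%R%:R) = ((1 <= x)%R%:R + (- 1 <= x)%R%:R) / 2.
Proof.
have p01 : 0 <= (2^-1 : R) <= 1 by rewrite invr_ge0 ler0n/= invf_le1// ler1n.
rewrite /mean /Rintegral integral_bernoulli_prob//=.
rewrite /sym_bernoulli /= /sign_fun /unstable.onem.
by field.
Qed.

Lemma cdf_sym_bernoulli_lt (x : R) : x < -1 ->
  mean Q B (fun y => (y <= x)%R%:R) = 0.
Proof.
move=> x1; have x2 : x < 1 by lra.
by rewrite cdf_sym_bernoulli leNgt x2 leNgt x1 /= addr0 mul0r.
Qed.

Lemma cdf_sym_bernoulli_mid (x : R) : -1 <= x -> x < 1 ->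
  mean Q B (fun y => (y <= x)%R%:R) = 2^-1.
Proof.
by move=> x1 x2; rewrite cdf_sym_bernoulli x1 leNgt x2 /= add0r mul1r.
Qed.

Lemma cdf_sym_bernoulli_ge (x : R) : 1 <= x ->
  mean Q B (fun y => (y <= x)%R%:R) = 1.
Proof.
move=> x1; have x2 : -1 <= x by lra.
by rewrite cdf_sym_bernoulli x1 x2 /= divff.
Qed.

(** The indicator of [|y| - 1] being outside of [[- r, r]], up to the endpoints,
    as a combination of indicators of half-lines [y <= x], whose
    expectations are values of the distribution function. *)
Definition off_signs (r y : R) : R :=
  (1 - (y <= 1 + r)%R%:R) + (y <= - 1 - r)%R%:R
  + ((y <= 1 - r)%R%:R - (y <= - 1 + r)%R%:R).

Lemma off_signsP (r y : R) : 0 < r -> r <= 2^-1 ->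
  off_signs r y = 1 \/ off_signs r y = 0 /\ - (3 * r) <= y ^+ 2 - 1 <= 3 * r.
Proof.
move=> r0 r1; rewrite /off_signs.
have [y1|y1] := leP y (- 1 - r).
  have -> : y <= 1 + r by lra.
  have -> : y <= 1 - r by lra.
  have -> : y <= - 1 + r by lra.
  by left; rewrite /=; ring.
have [y2|y2] := leP y (- 1 + r).
  have -> : y <= 1 + r by lra.
  have -> : y <= 1 - r by lra.
  by right; split; [rewrite /=; ring|apply/andP; split; nra].
have [y3|y3] := leP y (1 - r).
  have -> : y <= 1 + r by lra.
  by left; rewrite /=; ring.
have [y4|y4] := leP y (1 + r).
  by right; split; [rewrite /=; ring|apply/andP; split; nra].
by left; rewrite /=; ring.
Qed.

(** Near [1] and [-1] the deviation is small; elsewhere it is at most [K], unless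
    it is dominated by its square over [K]. *)
Lemma deviation_split (r K y : R) : 0 < r -> r <= 2^-1 -> 0 < K ->
  (y ^+ 2 - 1) ^+ 2
    <= 9 * r + K * off_signs r y + K^-1 * ((y ^+ 2 - 1) ^+ 2) ^+ 2.
Proof.
move=> r0 r1 K0; have := off_signsP y r0 r1.
set b := off_signs r y; set u := y ^+ 2 - 1; set z := u ^+ 2.
have z0 : 0 <= z by exact: sqr_ge0.
have zK0 : 0 <= K^-1 * z ^+ 2 by rewrite mulr_ge0 ?invr_ge0 ?sqr_ge0// ltW.
case=> [->|[-> /andP[u1 u2]]].
  rewrite mulr1.
  have [zK|Kz] := leP z K; first by lra.
  have : z <= K^-1 * z ^+ 2 by rewrite mulrC ler_pdivlMr// expr2 ler_wpM2l// ltW.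
  by lra.
have : z <= (3 * r) ^+ 2 by rewrite -subr_ge0 /z subr_sqr mulr_ge0//; lra.
have : (3 * r) ^+ 2 <= 9 * r by rewrite expr2; nra.
by lra.
Qed.

Lemma deviation_le_expR (y : R) :
  ((y ^+ 2 - 1) ^+ 2) ^+ 2 <= 8`!%:R * expR `|y|.
Proof.
have f80 : 0 < 8`!%:R :> R by rewrite ltr0n fact_gt0.
have y8 : `|y| ^+ 8 = (y ^+ 2) ^+ 4.
  by rewrite -normrX -exprM ger0_norm// exprn_even_ge0.
have := expR_ge1Dxn 7 (normr_ge0 y); rewrite y8 -(ler_pM2l f80).
apply: le_trans; rewrite mulrDr mulr1 mulrCA divff ?gt_eqF// mulr1.
have f81 : 1 <= 8`!%:R :> R by rewrite ler1n fact_gt0.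
set t := y ^+ 2; have t0 : 0 <= t by exact: sqr_ge0.
have t40 : 0 <= t ^+ 4 by rewrite exprn_ge0.
rewrite -exprM; have [t1|t1] := leP t 1.
  have : (t - 1) ^+ 2 <= 1 by nra.
  move=> /(exprn_ile1 2 (sqr_ge0 _)); rewrite -exprM => /le_trans; apply.
  by lra.
have : (t - 1) ^+ 4 <= t ^+ 4 by rewrite lerXn2r ?nnegrE//; lra.
by rewrite mulnE /=; lra.
Qed.

Section convergence_to_signs.
Context (d : nat -> measure_display)
  (T : forall n, measurableType (d n)) (P : forall n, probability (T n) R)
  (Y : forall n, {RV P n >-> R}).
Hypothesis lY : forall n, light_tailed (P n) (Y n).
Hypothesis Y2 : forall n, mean (P n) (Y n) (fun y => y ^+ 2) = 1.
Let f4 n := mean (P n) (Y n) (fun y => y ^+ 4).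
Local Notation F n x := (mean (P n) (Y n) (fun y => (y <= x)%R%:R)).
Local Notation FB x := (mean Q B (fun y => (y <= x)%R%:R)).

Let tX m : tame (fun y : R => y ^+ m).
Proof. by apply: tameX; exact: tame_id. Qed.

Let tdev : tame (fun y : R => (y ^+ 2 - 1) ^+ 2).
Proof. by apply: tameX; apply: tameB; [exact: tX|exact: tame_cst]. Qed.

Lemma mean_deviation n :
  mean (P n) (Y n) (fun y => (y ^+ 2 - 1) ^+ 2) = f4 n - 1.
Proof.
have t2 := tameZ 2 (tX 2%N).
have := meanB (lY n) (tameB (tX 4%N) t2) (tame_cst (-1)).
rewrite (meanB (lY n) (tX 4%N) t2) (meanZ (lY n) _ (tX 2%N)) Y2 mean_cst -/(f4 n) => H.
rewrite (@eq_mean _ _ _ _ _ _ (fun y => y ^+ 4 - 2 * y ^+ 2 - cst (-1) y)).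
  by rewrite H; ring.
by move=> y; rewrite /cst; ring.
Qed.

Lemma fourth_moment_ge1 n : 1 <= f4 n.
Proof. by rewrite -subr_ge0 -mean_deviation; apply: mean_ge0 => y; exact: sqr_ge0. Qed.

(** Uniform integrability: the exponential moments bound the means of
    [(y^2 - 1)^4], so that by [deviation_split] it suffices that the mean of
    [off_signs] vanishes, and this is read on the distribution functions at
    the four continuity points [1 + r], [1 - r], [-1 + r] and [-1 - r]. *)
Lemma fourth_moment_to1 :
  (exists C, \forall n \near \oo, mean (P n) (Y n) (fun y => expR (1 * `|y|)) <= C) ->
  cvg_in_distribution Y B -> f4 n @[n --> \oo] --> (1 : R).
Proof.
move=> [C0 YC0] /(cvg_cdfP lY light_tailed_sym_bernoulli) cF.
apply/cvgrPdist_le => e e0.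
(* C bounds the means of (y^2 - 1)^4; the added 1 makes it positive. *)
pose C := `|C0| * 8`!%:R + 1.
have Cp : 0 < C by rewrite ltr_wpDl// mulr_ge0.
pose K := 3 * C / e.
have K0 : 0 < K by rewrite divr_gt0// mulr_gt0.
have CK : C / K = e / 3 by rewrite /K; field; rewrite !gt_eqF.
pose dl := Num.min 2^-1 (e / 27).
have d0 : 0 < dl by rewrite lt_min invr_gt0 ltr0n/= divr_gt0.
have d1 : dl <= 2^-1 by rewrite ge_min lexx.
have de : dl <= e / 27 by rewrite ge_min lexx orbT.
pose bad := off_signs dl.
have cFx (x : R) : dl <= `|x - 1| -> dl <= `|x + 1| -> F n x @[n --> \oo] --> FB x.
  move=> x1 x2; apply: cF => u u0; exists (dl / 2); first by rewrite divr_gt0.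
  move=> y yx; rewrite !cdf_sym_bernoulli.
  have -> : (1 <= y) = (1 <= x).
    move: yx x1; rewrite ler_norml => /andP[? ?]; rewrite ler_normr => /orP[?|?].
      by apply/idP/idP => _; lra.
    by apply/idP/idP => ?; lra.
  have -> : (- 1 <= y) = (- 1 <= x).
    move: yx x2; rewrite ler_norml => /andP[? ?]; rewrite ler_normr => /orP[?|?].
      by apply/idP/idP => _; lra.
    by apply/idP/idP => ?; lra.
  by rewrite subrr normr0 ltW.
have c1 : F n (1 + dl) @[n --> \oo] --> (1 : R).
  have := cFx (1 + dl); rewrite cdf_sym_bernoulli_ge; last lra.
  by apply; rewrite ler_normr; apply/orP; left; lra.
have c2 : F n (- 1 - dl) @[n --> \oo] --> (0 : R).
  have := cFx (- 1 - dl); rewrite cdf_sym_bernoulli_lt; last lra.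
  by apply; rewrite ler_normr; apply/orP; right; lra.
have c3 : F n (1 - dl) @[n --> \oo] --> (2^-1 : R).
  have := cFx (1 - dl); rewrite cdf_sym_bernoulli_mid; [|lra|lra].
  by apply; rewrite ler_normr; apply/orP; [right|left]; lra.
have c4 : F n (- 1 + dl) @[n --> \oo] --> (2^-1 : R).
  have := cFx (- 1 + dl); rewrite cdf_sym_bernoulli_mid; [|lra|lra].
  by apply; rewrite ler_normr; apply/orP; [right|left]; lra.
have tl (x : R) : tame (fun y : R => (y <= x)%R%:R) by exact: tame_ler.
have tb : tame bad.
  exact: tameD (tameD (tameB (tame_cst 1) (tl _)) (tl _)) (tameB (tl _) (tl _)).
have mbad n : mean (P n) (Y n) bad = (1 - F n (1 + dl)) + F n (- 1 - dl)
   + (F n (1 - dl) - F n (- 1 + dl)).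
  have t1 := tameB (tame_cst 1) (tl (1 + dl)).
  rewrite -[X in X - _ + _ + _](mean_cst (Y n) 1).
  rewrite -(meanB (lY n) (tame_cst 1) (tl (1 + dl))) -(meanD (lY n) t1 (tl (- 1 - dl))).
  rewrite -(meanB (lY n) (tl _) (tl _)).
  by rewrite -(meanD (lY n) (tameD t1 (tl _)) (tameB (tl _) (tl _))).
have cbad : mean (P n) (Y n) bad @[n --> \oo] --> 0.
  under eq_fun do rewrite mbad.
  have -> : 0 = (1 - 1) + 0 + (2^-1 - 2^-1) :> R by rewrite !subrr !addr0.
  by apply: cvgD; [apply: cvgD => //; apply: cvgB => //; exact: cvg_cst|exact: cvgB].
have e3K : 0 < e / 3 / K by rewrite divr_gt0// divr_gt0.
have nbad : \forall n \near \oo, mean (P n) (Y n) bad <= e / 3 / K.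
  by apply: (cvgr_le _ cbad).
have t8 : tame (fun y : R => ((y ^+ 2 - 1) ^+ 2) ^+ 2) by apply: tameX.
have point (y : R) : (y ^+ 2 - 1) ^+ 2
    <= e / 3 + K * bad y + K^-1 * ((y ^+ 2 - 1) ^+ 2) ^+ 2.
  apply: (le_trans (deviation_split y d0 d1 K0)).
  by rewrite lerD2r lerD2r; lra.
near=> n.
have YC : mean (P n) (Y n) (fun y => ((y ^+ 2 - 1) ^+ 2) ^+ 2) <= C.
  have tE := @tame_expR_norm R 1 ler01.
  apply: (@le_trans _ _ (8`!%:R * C0)); last first.
    by rewrite mulrC /C (le_trans (ler_wpM2r (ler0n _ _) (ler_norm C0)))// lerDl.
  apply: (@le_trans _ _ (8`!%:R * mean (P n) (Y n) (fun y => expR (1 * `|y|)))); last first.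
    by rewrite ler_wpM2l//; near: n.
  rewrite -(meanZ (lY n) _ tE); apply: mean_le => //; first exact: tameZ.
  by move=> y; rewrite mul1r; exact: deviation_le_expR.
have nb : mean (P n) (Y n) bad <= e / 3 / K by near: n.
rewrite distrC ger0_norm ?subr_ge0 ?fourth_moment_ge1// -mean_deviation.
apply: (@le_trans _ _ (e / 3 + K * mean (P n) (Y n) bad
    + K^-1 * mean (P n) (Y n) (fun y => ((y ^+ 2 - 1) ^+ 2) ^+ 2))).
  rewrite -[X in X + _ + _](mean_cst (Y n) (e / 3)).
  rewrite -(meanZ (lY n) _ tb) -(meanZ (lY n) _ t8).
  have tK := tameZ K tb.
  rewrite -(meanD (lY n) (tame_cst _) tK) -(meanD (lY n) (tameD (tame_cst _) tK) (tameZ _ t8)).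
  apply: mean_le => //.
  by apply: tameD; [apply: tameD => //; exact: tame_cst|exact: tameZ].
have : K * mean (P n) (Y n) bad <= e / 3.
  by rewrite mulrC -ler_pdivlMr.
have : K^-1 * mean (P n) (Y n) (fun y => ((y ^+ 2 - 1) ^+ 2) ^+ 2) <= e / 3.
  by rewrite -CK mulrC ler_pM2r// invr_gt0.
by lra.
Unshelve. all: by end_near. Qed.

Hypothesis sY : forall n, symmetric_law (P n) (Y n).

(** By symmetry, twice the distribution function at [x] is the mean of
    [1(y <= x) + 1(- y <= x)]. This function of [y] takes the value expected for
    the Bernoulli law unless [y^2] lies on the other side of [x^2] from 1, where
    [(y^2 - 1)^2 >= (x^2 - 1)^2]. *)
Lemma cvg_in_distribution_signs :
  f4 n @[n --> \oo] --> (1 : R) -> cvg_in_distribution Y B.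
Proof.
move=> f41; apply/(cvg_cdfP lY light_tailed_sym_bernoulli) => x cx.
have e4 : 0 < (4^-1 : R) by rewrite invr_gt0.
have x1 : x != 1.
  apply/eqP => x1; have [r r0 cr] := cx _ e4.
  pose z : R := Num.max 0 (1 - r).
  have z0 : 0 <= z by rewrite le_max lexx.
  have zr : 1 - r <= z by rewrite le_max lexx orbT.
  have z1 : z < 1 by rewrite gt_max ltr01/=; lra.
  have zd : `|z - 1| <= r by rewrite ler0_norm; lra.
  have := cr z; rewrite x1 => /(_ zd).
  rewrite (@cdf_sym_bernoulli_mid z) ?cdf_sym_bernoulli_ge//; last lra.
  by rewrite ler0_norm; lra.
have xN1 : x != -1.
  apply/eqP => x2; have [r r0 cr] := cx _ e4.
  have zd : `|- 1 - r - (- 1)| <= r by rewrite ler0_norm; lra.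
  have := cr (- 1 - r); rewrite x2 => /(_ zd).
  rewrite cdf_sym_bernoulli_lt; last lra.
  rewrite cdf_sym_bernoulli_mid; [|lra|lra].
  by rewrite ler0_norm; lra.
pose kp := (x ^+ 2 - 1) ^+ 2.
have kp0 : 0 < kp.
  by rewrite exprn_even_gt0//= subr_eq0 sqrf_eq1 negb_or x1 xN1.
have sep (y : R) : (0 <= x ^+ 2 - 1 <= y ^+ 2 - 1) || (y ^+ 2 - 1 <= x ^+ 2 - 1 <= 0) ->
    1 <= kp^-1 * (y ^+ 2 - 1) ^+ 2.
  move=> H; rewrite mulrC ler_pdivlMr// mul1r /kp.
  rewrite -subr_ge0 subr_sqr.
  by case/orP: H => /andP[? ?]; [rewrite mulr_ge0|rewrite mulr_le0]; lra.
have ratio0 (y : R) : 0 <= kp^-1 * (y ^+ 2 - 1) ^+ 2.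
  by rewrite mulr_ge0 ?invr_ge0 ?sqr_ge0// ltW.
have point (y : R) : `|((y <= x)%R%:R + (- y <= x)%R%:R) - 2 * FB x|
    <= kp^-1 * (y ^+ 2 - 1) ^+ 2.
  have D0 (u : R) : u = 0 -> `|u| <= kp^-1 * (y ^+ 2 - 1) ^+ 2.
    by move=> ->; rewrite normr0.
  have D1 (u : R) : `|u| = 1 ->
      (0 <= x ^+ 2 - 1 <= y ^+ 2 - 1) || (y ^+ 2 - 1 <= x ^+ 2 - 1 <= 0) ->
      `|u| <= kp^-1 * (y ^+ 2 - 1) ^+ 2.
    by move=> -> /sep.
  have [x_lt|x_ge] := ltP x (-1).
    rewrite cdf_sym_bernoulli_lt// mulr0 subr0.
    have [yx|yx] := leP y x; have [nyx|nyx] := leP (- y) x; first lra.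
    - by apply: D1; [rewrite addr0 normr1|apply/orP; left; apply/andP; split; nra].
    - by apply: D1; [rewrite add0r normr1|apply/orP; left; apply/andP; split; nra].
    - by apply: D0; rewrite addr0.
  have [x_ge1|x_lt1] := leP 1 x.
    rewrite cdf_sym_bernoulli_ge// mulr1.
    have [yx|yx] := leP y x; have [nyx|nyx] := leP (- y) x; last lra.
    - by apply: D0; rewrite /=; lra.
    - apply: D1; last by apply/orP; left; apply/andP; split; nra.
      by rewrite ler0_norm /=; lra.
    - apply: D1; last by apply/orP; left; apply/andP; split; nra.
      by rewrite ler0_norm /=; lra.
  rewrite cdf_sym_bernoulli_mid// divff//.
  have [yx|yx] := leP y x; have [nyx|nyx] := leP (- y) x.
  - apply: D1; last by apply/orP; right; apply/andP; split; nra.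
    by rewrite ger0_norm /=; lra.
  - by apply: D0; rewrite /=; lra.
  - by apply: D0; rewrite /=; lra.
  - apply: D1; last by apply/orP; right; apply/andP; split; nra.
    by rewrite ler0_norm /=; lra.
have cmp n : `|F n x - FB x| <= kp^-1 * (f4 n - 1).
  have tn : tame (fun y : R => (- y <= x)%R%:R) by exact: tame_opp (tame_ler x).
  have t2 := tameD (tame_ler x) tn.
  have := norm_mean_le (lY n) (tameB t2 (tame_cst (2 * FB x))) (tameZ kp^-1 tdev) point.
  rewrite (meanZ (lY n) _ tdev) mean_deviation.
  rewrite (meanB (lY n) t2 (tame_cst _)) (meanD (lY n) (tame_ler x) tn) mean_cst -sY.
  rewrite -mulr2n -[X in `|X - _|]mulr_natl -mulrBr normrM ger0_norm//.
  have : 0 <= `|F n x - FB x| by [].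
  by lra.
apply/cvgrPdist_le => e e0.
have ke0 : 0 < kp * e by rewrite mulr_gt0.
move/cvgrPdist_le : f41 => /(_ _ ke0) f41.
near=> n; rewrite distrC; apply: (le_trans (cmp n)).
rewrite mulrC ler_pdivrMr// mulrC.
have : `|1 - f4 n| <= kp * e by near: n.
by apply: le_trans; rewrite distrC ler_norm.
Unshelve. all: by end_near. Qed.

End convergence_to_signs.
End sign_law.

(** * Limit criteria *)

Lemma cvg_EFinP (R : realType) (f : nat -> R) (l : R) :
  ((f n)%:E @[n --> \oo] --> l%:E) <-> (f n @[n --> \oo] --> l).
Proof.
by split=> [|fl]; [exact: fine_cvg|apply: cvg_EFin => //; near=> n].
Unshelve. all: by end_near. Qed.

(** The normal distribution function is continuous, so convergence holds at every
    point. *)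
Lemma cvg_std_normalP (R : realType) (d : nat -> measure_display)
  (T : forall n, measurableType (d n)) (P : forall n, probability (T n) R)
  (Y : forall n, {RV P n >-> R}) : (forall n, light_tailed (P n) (Y n)) ->
  cvg_in_distribution Y (std_normal R) ->
  forall x, mean (P n) (Y n) (fun y => (y <= x)%R%:R) @[n --> \oo] -->
    mean (normal_prob (0 : R) 1) (std_normal R) (fun y => (y <= x)%R%:R).
Proof.
move=> lY /(cvg_cdfP lY (@light_tailed_std_normal R)) cF x; apply: cF => e e0.
have p0 : 0 < normal_peak (1 : R) by exact: normal_peak_gt0.
exists (e / normal_peak 1); first by rewrite divr_gt0.
move=> y; rewrite ler_pdivlMr// => yx.
have [xy|/ltW yx'] := leP x y.
  have := std_normal_lipschitz xy.
  move: yx; rewrite (ger0_norm (_ : 0 <= y - x)) ?subr_ge0// mulrC => yx H.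
  rewrite ger0_norm ?subr_ge0; first exact: le_trans H yx.
  by apply: cdfr_le => //; exact: light_tailed_std_normal.
have := std_normal_lipschitz yx'.
move: yx; rewrite distrC (ger0_norm (_ : 0 <= x - y)) ?subr_ge0// mulrC => yx H.
rewrite distrC ger0_norm ?subr_ge0; first exact: le_trans H yx.
by apply: cdfr_le => //; exact: light_tailed_std_normal.
Qed.

Section weighted_laws.
Context (R : realType) (d : nat -> measure_display)
    (T : forall n, measurableType (d n)) (P : forall n, probability (T n) R)
    (Y : forall n, {RV P n >-> R}) (v : nat -> seq R).
Hypothesis size_v : forall n, size (v n) = n.+1.
Hypothesis lawY : forall n, weighted_law (P n) (Y n) (v n).
Let f4 n := mean (P n) (Y n) (fun y => y ^+ 4).
Local Notation Z := (std_normal R).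
Local Notation Q := (normal_prob (0 : R) 1).
Let V n := \sum_(x <- v n) x.
Let s2 n := \sum_(x <- v n) x ^+ 2.

Let v_ge n x : x \in v n -> 4^-1 <= x.
Proof. by have [[+ _ _] _] := lawY n; apply. Qed.

Let lY n : light_tailed (P n) (Y n). Proof. by have [[]] := lawY n. Qed.

Let sY n : symmetric_law (P n) (Y n). Proof. by have [[]] := lawY n. Qed.

Let Y2 n : mean (P n) (Y n) (fun y => y ^+ 2) = 1.
Proof. by have [_ []] := lawY n. Qed.

Let f4E n : f4 n = 3 + (V n - 6 * s2 n) / V n ^+ 2.
Proof. by have [_ []] := lawY n. Qed.

Let mgf_square n s : mean (P n) (Y n) (fun y => expR (s * y)) ^+ 2 =
  \prod_(x <- v n) (1 + x * (expR (s / (2 * Num.sqrt (V n)))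
     - expR (- (s / (2 * Num.sqrt (V n))))) ^+ 2).
Proof. by have [_ []] := lawY n. Qed.

Let V_gt0 n : 0 < V n. Proof. exact: (variance_gt0 size_v v_ge). Qed.

Lemma fourth_moment_lt3 n : f4 n < 3.
Proof.
rewrite f4E -[ltRHS]addr0 ltrD2l pmulr_llt0 ?invr_gt0 ?exprn_gt0//.
have := variance_le_squares v_ge n; rewrite -/(V n) -/(s2 n).
by have := V_gt0 n; lra.
Qed.

(** As [v_j >= 1/4] gives [V <= 4 sum_j v_j^2], the defect of the fourth moment,
    [(6 sum_j v_j^2 - V) / V^2], is at least [2 sum_j v_j^2 / V^2]. *)
Lemma squares_negligible : f4 n @[n --> \oo] --> (3 : R) ->
  s2 n / V n ^+ 2 @[n --> \oo] --> (0 : R).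
Proof.
move=> f43.
apply: (@squeeze_cvgr _ _ _ _ (fun=> 0) (fun n => (3 - f4 n) / 2)).
- near=> n; have V2 : 0 < V n ^+ 2 by rewrite exprn_gt0.
  have sV := variance_le_squares v_ge n; rewrite -/(V n) -/(s2 n) in sV.
  have V0 := V_gt0 n.
  apply/andP; split; first by rewrite divr_ge0 ?(ltW V2)//; lra.
  rewrite f4E opprD addrA subrr add0r -mulNr ler_pdivrMr// mulrAC divfK ?gt_eqF//.
  by rewrite ler_pdivlMr//; lra.
- exact: cvg_cst.
- have -> : 0 = (3 - 3) / 2 :> R by rewrite subrr mul0r.
  by apply: cvgMl; apply: cvgB => //; exact: cvg_cst.
Unshelve. all: by end_near. Qed.

Let mgf_ge0 n s : 0 <= mean (P n) (Y n) (fun y => expR (s * y)).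
Proof. by apply: mean_ge0 => y; exact: expR_ge0. Qed.

Lemma mgf_to_gaussian : f4 n @[n --> \oo] --> (3 : R) -> forall s,
  mean (P n) (Y n) (fun y => expR (s * y)) @[n --> \oo]
    --> mean Q Z (fun y => expR (s * y)).
Proof.
move=> /squares_negligible r0 s; rewrite mean_std_normal_expR.
exact: (mgf_gaussian size_v v_ge mgf_ge0 mgf_square).
Qed.

Lemma normal_limitP :
  cvg_in_distribution Y Z <-> f4 n @[n --> \oo] --> (3 : R).
Proof.
have lZ := @light_tailed_std_normal R; have sZ := @std_normal_symmetric R.
split=> [/(cvg_std_normalP lY) cF|/mgf_to_gaussian]; last first.
  exact: cvg_in_distribution_of_mgf.
apply/cvgrPdist_le => e e0.
have := fourth_moment_lsc lY lZ sY sZ e0 cF; rewrite std_normal_moment4.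
apply: filterS => n f4n; have := fourth_moment_lt3 n.
by rewrite -/(f4 n) in f4n * => f4n3; rewrite ger0_norm; lra.
Qed.

Lemma moments_to_gaussian : f4 n @[n --> \oo] --> (3 : R) -> cvg_moments Y Z.
Proof.
move=> /mgf_to_gaussian cmgf m.
have lZ := @light_tailed_std_normal R.
rewrite momentE//; under eq_fun do rewrite (momentE (@lY _)).
apply/cvg_EFinP; by apply: mean_power_cvg.
Qed.

Lemma signs_limitP :
  cvg_in_distribution Y (sym_bernoulli R) <-> f4 n @[n --> \oo] --> (1 : R).
Proof.
split; last exact: (cvg_in_distribution_signs lY Y2 sY).
apply: (fourth_moment_to1 lY Y2).
exists (expR ((1 ^+ 2 + 1) / 2) + expR (((- 1) ^+ 2 + 1) / 2)).
near=> n; apply: (le_trans (mean_expR_norm_le (lY n) ler01)).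
apply: lerD; near: n.
  exact: (mgf_bounded size_v v_ge mgf_ge0 mgf_square).
exact: (mgf_bounded size_v v_ge mgf_ge0 mgf_square).
Unshelve. all: by end_near. Qed.

End weighted_laws.

Lemma cvg_in_distribution_shift (R : realType) (d : nat -> measure_display)
    (T : forall n, measurableType (d n)) (P : forall n, probability (T n) R)
    (d' : measure_display) (T' : measurableType d') (Q : probability T' R)
    (Y : forall n, {RV P n >-> R}) (Z : {RV Q >-> R}) :
  cvg_in_distribution (fun n => Y n.+1) Z <-> cvg_in_distribution Y Z.
Proof.
split=> H x cx; first by rewrite -cvg_shiftS; exact: H.
by have := H x cx; rewrite -cvg_shiftS.
Qed.

Theorem theorem1p1 (R : realType) (d : nat -> measure_display)
    (T : forall n, measurableType (d n)) (P : forall n, probability (T n) R)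
    (X : forall n, {RV P n >-> R})
    (X_range : forall n, (0 < n)%N ->
       forall t : T n, exists2 k : nat, (k <= n)%N & X n t = k%:R)
    (pgf_degree : forall n, (0 < n)%N -> size (prob_gen_poly n (X n)) = n.+1)
    (pgf_roots : forall n, (0 < n)%N -> unit_roots (prob_gen_poly n (X n))) :
  let Xs n : {RV P n >-> R} := standardize (X n) in
  let fourth n : \bar R := moment (P n) 4 (Xs n) in
  [/\ (forall n, (0 < n)%N -> (1 <= fourth n)%E /\ (fourth n < 3%:E)%E),
      (cvg_in_distribution Xs (std_normal R) <->
         fourth n @[n --> \oo] --> 3%:E)
      /\ ((cvg_in_distribution Xs (std_normal R)
             /\ cvg_moments Xs (std_normal R)) <->
         fourth n @[n --> \oo] --> 3%:E)
    & cvg_in_distribution Xs (sym_bernoulli R) <->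
        fourth n @[n --> \oo] --> 1%:E].

Proof.
move=> Xs fourth.
pose X' n := X n.+1.
have /choice[v vP] n : exists v, size v = n.+1 /\
    weighted_law (P n.+1) (standardize (X' n)) v.
  have n0 : (0 < n.+1)%N by [].
  have [v] := unitary_law n0 (X_range _ n0) (pgf_degree _ n0) (pgf_roots _ n0).
  by exists v.
have size_v n : size (v n) = n.+1 by case: (vP n).
have law n : weighted_law (P n.+1) (standardize (X' n)) (v n) by case: (vP n).
have lY n : light_tailed (P n.+1) (standardize (X' n)) by case: (law n) => -[].
have Y2 n : mean (P n.+1) (standardize (X' n)) (fun y => y ^+ 2) = 1.
  by case: (law n) => _ [].
have fE n : fourth n.+1 = (mean (P n.+1) (standardize (X' n)) (fun y => y ^+ 4))%:E.
  by rewrite /fourth (momentE (lY n)).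
have f4P (l : R) : fourth n @[n --> \oo] --> l%:E <->
    mean (P n.+1) (standardize (X' n)) (fun y => y ^+ 4) @[n --> \oo] --> l.
  rewrite -cvg_shiftS; under eq_fun do rewrite fE.
  exact: cvg_EFinP.
have normalP : cvg_in_distribution Xs (std_normal R) <->
    fourth n @[n --> \oo] --> 3%:E.
  rewrite -cvg_in_distribution_shift f4P.
  exact: (normal_limitP size_v law).
split.
- case=> // n _; rewrite fE lee_fin lte_fin; split.
    exact: (fourth_moment_ge1 lY Y2).
  exact: (fourth_moment_lt3 size_v law).
- split=> //; split=> [[/normalP //]|f3]; split; first exact/normalP.
  move=> m; rewrite -cvg_shiftS.
  by move/f4P : f3 => /(moments_to_gaussian size_v law); apply.
- rewrite -cvg_in_distribution_shift f4P.
  exact: (signs_limitP size_v law).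
Qed.
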